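(* Given a nilpotent in a simple Lie algebra $\mathfrak g$ of classical type $\mathrm B$, $\mathrm C$ or $\mathrm D$, there is an abelian subspace of half dimension in $\mathfrak g_1$ (i.e. of dimension $\frac12\dim\mathfrak g_1$) if and only if the partition corresponding to the nilpotent satisfies the following conditions. Type $\mathrm C$: there is no more than one parity change along the partition. Types $\mathrm B$ and $\mathrm D$: there are no more than two parity changes and, if there is at least one parity change, then \begin{itemize} \item if the largest part of the partition is even, then there is only one parity change, and in the $\mathrm B$ case moreover it (the largest part) must be the unique even part and must have multiplicity $2$; \item if there are two parity changes, then the largest part of the partition is odd, there is a unique even part, it has multiplicity $2$, and all smaller parts are equal to $1$. \end{itemize} Thus, abelian subspaces of half dimension in $\mathfrak g_1$ occur precisely for nilpotents corresponding to partitions of one of the following kinds (with $k\le\ell$ throughout): \begin{itemize} \item any type: $\left[\cdots(2k-2)^{\nu_{2k-2}}(2k)^{\nu_{2k}}(2\ell+1)^{\nu_{2\ell+1}}(2\ell+3)^{\nu_{2\ell+3}}\cdots\right]$; \item type $\mathrm C$ or $\mathrm D$: $\left[\cdots(2k-3)^{\nu_{2k-3}}(2k-1)^{\nu_{2k-1}}(2\ell)^{\nu_{2\ell}}(2\ell+2)^{\nu_{2\ell+2}}\cdots\right]$; \item type $\mathrm B$ or $\mathrm D$: $\left[1^{\nu_1}(2k)^2(2\ell+1)^{\nu_{2\ell+1}}(2\ell+3)^{\nu_{2\ell+3}}\cdots\right]$; \item type $\mathrm B$: $\left[\cdots(2k-3)^{\nu_{2k-3}}(2k-1)^{\nu_{2k-1}}(2\ell)^2\right]$.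 \end{itemize}
   Context: The base field is $\mathbb C$. For a nilpotent $e\in\mathfrak g$ choose an $\mathfrak{sl}_2$-triple $(e,h,f)$, i.e. $[e,f]=h$, $[h,e]=2e$, $[h,f]=-2f$, and let $\mathfrak g_j=\{x\in\mathfrak g:[h,x]=jx\}$. An abelian subspace is a linear subspace any two elements of which commute (the zero subspace counts, so if $\mathfrak g_1=0$ there is trivially one of half dimension). For $\mathfrak g$ of type B, C, D, i.e. $\mathfrak{so}_{2r+1}$, $\mathfrak{sp}_{2r}$, $\mathfrak{so}_{2r}$, the partition corresponding to $e$ consists of the sizes of the Jordan blocks of $e$ acting on the standard representation. In types B and D all even parts have even multiplicity; in type C all odd parts have even multiplicity. The notation $[a^{m_a}b^{m_b}\cdots]$ means the partition with parts $a$ of multiplicity $m_a$, $b$ of multiplicity $m_b$, and so on; multiplicities $\nu_j\ge0$ may be zero (subject to the parity constraints of the given type). A parity change along the partition is a pair of consecutive distinct parts (when the distinct parts are listed in order of size) having opposite parities. In the list, dots to the left stand for all smaller positive parts of the same parity as the part shown, and dots to the right for larger parts of the same parity. ''Any type'' means any of the types B, C, D considered here. *)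

(* Defs.v *)
From HB Require Import structures.
From mathcomp Require Import all_boot all_order all_algebra.
From mathcomp Require Import reals.
From mathcomp Require Import complex.

Set Implicit Arguments.
Unset Strict Implicit.
Unset Printing Implicit Defensive.

Import GRing.Theory.
Local Open Scope ring_scope.

Section LieMatrices.
Variables (F : fieldType) (n : nat).
Implicit Types (x y e h f S : 'M[F]_n) (g U V I : {vspace 'M[F]_n}).

Definition lie_bracket x y : 'M[F]_n := x *m y - y *m x.

Definition form_defect S x : 'M[F]_n := x^T *m S + S *m x.

Fact form_defect_is_linear S : linear (form_defect S).
Proof.
move=> a x y; rewrite /form_defect linearP /= mulmxDl mulmxDr scalerDr.
by rewrite -scalemxAl -scalemxAr addrACA.
Qed.

HB.instance Definition _ S :=
  GRing.isLinear.Build F 'M[F]_n 'M[F]_n _ (form_defect S)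
    (form_defect_is_linear S).

(* Matrices acting on column vectors that are skew-adjoint with respect to
   the bilinear form (v, w) |-> v^T S w. *)
Definition form_lie S : {vspace 'M[F]_n} := lker (linfun (form_defect S)).

Lemma mem_form_lie S x : (x \in form_lie S) = (x^T *m S + S *m x == 0).
Proof. by rewrite memv_ker lfunE. Qed.

Definition weight_defect h (a : F) x : 'M[F]_n := lie_bracket h x - a *: x.

Fact weight_defect_is_linear h a : linear (weight_defect h a).
Proof.
move=> b x y; rewrite /weight_defect /lie_bracket.
rewrite mulmxDr mulmxDl -scalemxAr -scalemxAl scalerDr !scalerBr.
rewrite !scalerA [a * b]mulrC opprD -!scalerA.
rewrite (addrACA (b *: (h *m x))) opprD.
exact: addrACA.
Qed.

HB.instance Definition _ h a :=
  GRing.isLinear.Build F 'M[F]_n 'M[F]_n _ (weight_defect h a)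
    (weight_defect_is_linear h a).

Definition weight_space g h (a : F) : {vspace 'M[F]_n} :=
  (g :&: lker (linfun (weight_defect h a)))%VS.

Lemma mem_weight_space g h a x :
  (x \in weight_space g h a) = (x \in g) && (lie_bracket h x == a *: x).
Proof. by rewrite memv_cap memv_ker lfunE /= /weight_defect subr_eq0. Qed.

Definition sl2_triple g e h f : Prop :=
  [/\ [/\ e \in g, h \in g & f \in g],
      lie_bracket e f = h,
      lie_bracket h e = 2%:R *: e
    & lie_bracket h f = - (2%:R *: f)].

Definition abelian_subspace U : Prop :=
  forall x y, x \in U -> y \in U -> lie_bracket x y = 0.

Definition lie_ideal g I : Prop :=
  (I <= g)%VS /\ forall x y, x \in g -> y \in I -> lie_bracket x y \in I.

Definition simple_lie g : Prop :=
  ~ abelian_subspace g /\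
  forall I, lie_ideal g I -> I = 0%VS \/ I = g.

(* Nilpotency in the standard representation; for elements of a simple
   classical Lie algebra this is the same as ad-nilpotency. *)
Definition nilpotent_mx e : Prop := exists k : nat, e ^+ k = 0.

Definition half_abelian_in V : Prop :=
  exists U : {vspace 'M[F]_n},
    [/\ (U <= V)%VS, abelian_subspace U & (2 * \dim U)%N = \dim V].

End LieMatrices.

Inductive classical_type : Set := TypeB | TypeC | TypeD.

Definition std_dim (X : classical_type) (r : nat) : nat :=
  match X with
  | TypeB => (r + r).+1
  | TypeC | TypeD => r + r
  end.

Definition std_form (F : fieldType) (X : classical_type) (r : nat) :
    'M[F]_(std_dim X r) :=
  match X with
  | TypeB | TypeD => 1%:M
  | TypeC => block_mx 0 1%:M (- 1%:M) 0
  end.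

(* so_(2r+1), sp_(2r), so_(2r) *)
Definition classical_lie (F : fieldType) (X : classical_type) (r : nat) :
    {vspace 'M[F]_(std_dim X r)} :=
  form_lie (std_form F X r).

Definition jordan_block (F : fieldType) (m : nat) : 'M[F]_m :=
  \matrix_(i < m, j < m) (j == i.+1 :> nat)%:R.

Definition jordan_mx (F : fieldType) (p : seq nat) :
    'M[F]_(\sum_(i < size p) tnth (in_tuple p) i) :=
  \mxdiag_(i < size p) jordan_block F (tnth (in_tuple p) i).

(* A partition is a nonincreasing sequence of positive integers.  The change
   of basis P is typed as a rectangular matrix, so that sumn p = n is a
   consequence of its invertibility rather than a cast. *)
Definition nilpotent_partition (F : fieldType) (n : nat)
    (e : 'M[F]_n) (p : seq nat) : Prop :=
  [/\ sorted geq p, 0%N \notin p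
    & exists P : 'M[F]_(n, \sum_(i < size p) tnth (in_tuple p) i),
        [/\ row_free P, row_full P & e *m P = P *m jordan_mx F p]].

Definition distinct_parts (p : seq nat) : seq nat := sort leq (undup p).

Definition parity_changes (p : seq nat) : nat :=
  let s := distinct_parts p in
  count (fun ab : nat * nat => odd ab.1 != odd ab.2) (zip s (behead s)).

Definition largest_part (p : seq nat) : nat := \max_(j <- p) j.

Definition unique_even_part (p : seq nat) (j : nat) : Prop :=
  [/\ j \in p, ~~ odd j & forall i : nat, i \in p -> ~~ odd i -> i = j].

Definition partition_condition (X : classical_type) (p : seq nat) : Prop :=
  match X with
  | TypeC => (parity_changes p <= 1)%N
  | TypeB | TypeD =>
    (parity_changes p <= 2)%N /\
    ((1 <= parity_changes p)%N ->
      (~~ odd (largest_part p) ->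
         parity_changes p = 1%N /\
         (X = TypeB ->
            unique_even_part p (largest_part p) /\
            count_mem (largest_part p) p = 2%N)) /\
      (parity_changes p = 2%N ->
         odd (largest_part p) /\
         exists j : nat,
           [/\ unique_even_part p j, count_mem j p = 2%N
             & forall i : nat, i \in p -> (i < j)%N -> i = 1%N]))
  end.

(* Multiplicities may vanish, so each kind of partition only constrains the
   parts that do occur; the bounds are allowed to start from k = 0, in which
   case the corresponding family of smaller parts is empty.  The parity
   constraints on multiplicities proper to each type are not repeated here:
   they hold for the partition of any element of the Lie algebra. *)

(* [.. (2k-2)^_ (2k)^_ (2l+1)^_ (2l+3)^_ ..] *)
Definition kind_even_odd (p : seq nat) : Prop :=
  exists k l : nat, (k <= l)%N /\
    forall j : nat, j \in p ->
      if odd j then (2 * l + 1 <= j)%N else (j <= 2 * k)%N.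

(* [.. (2k-3)^_ (2k-1)^_ (2l)^_ (2l+2)^_ ..]; for odd j the bound j < 2k
   says j <= 2k-1 without truncated subtraction. *)
Definition kind_odd_even (p : seq nat) : Prop :=
  exists k l : nat, (k <= l)%N /\
    forall j : nat, j \in p ->
      if odd j then (j < 2 * k)%N else (2 * l <= j)%N.

(* [1^_ (2k)^2 (2l+1)^_ (2l+3)^_ ..] *)
Definition kind_ones_even_odd (p : seq nat) : Prop :=
  exists k l : nat, [/\ (k <= l)%N, count_mem (2 * k)%N p = 2%N
    & forall j : nat, j \in p ->
        if odd j then (j == 1%N) || (2 * l + 1 <= j)%N else j == (2 * k)%N].

(* [.. (2k-3)^_ (2k-1)^_ (2l)^2] *)
Definition kind_odd_top_even (p : seq nat) : Prop :=
  exists k l : nat, [/\ (k <= l)%N, count_mem (2 * l)%N p = 2%N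
    & forall j : nat, j \in p ->
        if odd j then (j < 2 * k)%N else j == (2 * l)%N].

Definition listed_partition (X : classical_type) (p : seq nat) : Prop :=
  [\/ kind_even_odd p,
      (X = TypeC \/ X = TypeD) /\ kind_odd_even p,
      (X = TypeB \/ X = TypeD) /\ kind_ones_even_odd p
    | X = TypeB /\ kind_odd_top_even p].

(* Main.v *)
Require Import Defs.
From mathcomp Require Import all_boot all_order all_algebra.
From mathcomp Require Import boolp reals.
From mathcomp Require Import complex.
From mathcomp Require Import zify ring.

Set Implicit Arguments.
Unset Strict Implicit.
Unset Printing Implicit Defensive.

(** Write V for the standard representation, V_i for its h-weight spaces, d_i
    for their dimensions and < , > for the invariant form, which is
    eps-symmetric with eps = 1 in types B and D and eps = -1 in type C.

    Weights.  By the representation theory of sl_2 ([sl2_string_span]), V has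
    a basis of strings f^s v, with v killed by e, and comparing the kernels of
    the powers of e shows that the string lengths are the parts of p
    ([sl2_partition]).  Hence d_i, for i >= 0, counts the parts x > i with x
    and i of opposite parity ([weight_dim]), and d_i - d_(i+2) is the
    multiplicity of i + 1.

    Reduction to combinatorics.  The form pairs V_i with V_(-i), so V has a
    basis of weight vectors v_a whose dual basis is, up to signs, the same
    basis permuted by an involution sigma with at most one fixed point
    ([hyperbolic_basis_exists]).  An element of g_1 is determined by its
    components V_i -> V_(i+1), i >= 0, so g_1 has a basis of root vectors
    indexed by the edges of a graph in which all vertices of layer i, the
    basis vectors of weight i, are joined to all vertices of layer i + 1.
    Two root vectors fail to commute only when their edges are consecutive,
    or start at dual vertices a and sigma a of layer 0 (and, in the orthogonal
    case, end at different vertices).  For a generic one-parameter subgroup of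
    the torus, the leading terms of an abelian subspace U of g_1 span an
    abelian subspace of the same dimension made of root vectors
    ([half_abelian_independent]); so the question is whether there is a set
    of half of the edges without any such conflict.

    The extremal problem.  In a conflict-free set each vertex of layer >= 1
    has only incoming or only outgoing edges.  Let n_i be the number of
    vertices with incoming edges; then at most (d_i - n_i) n_(i+1) edges join
    the layers i and i + 1.  This is multilinear in the n_i, so the optimum
    is reached when whole layers are sources or targets, that is, when one
    takes all edges between the layers of some disjoint consecutive pairs.
    As d_i >= d_(i+2), the products w_i = d_i d_(i+1) decrease, and such a
    choice contains half of the edges only if these products are equal in pairs
    ([paired]).  Either one takes all edges between the layers 1-2, 3-4, ..., and
    needs w_0 = w_1, w_2 = w_3, ...; or one takes all edges between the layers
    2-3, 4-5, ... and those between 0-1 which start at a fixed vertex of each dual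
    pair, and needs w_1 = w_2, w_3 = w_4, ....  In type C this is all.
    In terms of p, all even parts are smaller than all odd parts, or the
    opposite.  In types B and D all vertices of layer 0 may also lead to the
    same vertex of layer 1.  For d_1 = 2 this leaves the other vertex of layer 1
    free for edges to layer 2, and w_2 = w_3, w_4 = w_5, ... is enough.  In type
    B, moreover, the self-dual vector leads to at most one vertex of layer 1, so
    that the second choice falls short of half of the edges if d_1 > 2.  The
    condition d_1 = 2 means that there is a unique even part, of
    multiplicity 2 ([weight_dim1_unique]); this accounts for the last two
    kinds of partitions ([extremal_orthogonal]). *)

(** * An extremal problem on layered graphs *)

Section Numeric.
Variables (d : nat -> nat) (N : nat).
Hypotheses (d_mono : forall i, d i.+2 <= d i) (d_N : forall i, N <= i -> d i = 0).

(** The products d j * d j.+1, for j >= i, are equal in pairs, that is,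
    d (i + 2k) * d (i + 2k + 1) = d (i + 2k + 1) * d (i + 2k + 2). *)
Definition paired (i : nat) : Prop :=
  forall k, d (i + 2 * k).+1 = 0 \/ d (i + 2 * k) = d (i + 2 * k).+2.

Lemma pairedS i : (d i.+1 = 0 \/ d i = d i.+2) -> paired i.+2 -> paired i.
Proof.
move=> di pi [|k]; first by rewrite muln0 addn0.
by have := pi k; rewrite (_ : i + 2 * k.+1 = i.+2 + 2 * k) //; lia.
Qed.

Lemma layer_size_antitone i k : d (i + 2 * k) <= d i.
Proof.
elim: k => [|k IHk]; first by rewrite muln0 addn0.
apply: leq_trans IHk; apply: leq_trans (d_mono _).
by rewrite (_ : i + 2 * k.+1 = (i + 2 * k).+2) //; lia.
Qed.

Lemma paired_empty i : d i = 0 -> paired i.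
Proof.
move=> d0 k; right; have := layer_size_antitone i k; have := d_mono (i + 2 * k); lia.
Qed.

Lemma paired_emptyS i : d i.+1 = 0 -> paired i.
Proof. by move=> d0 k; left; have := layer_size_antitone i.+1 k; rewrite addSn; lia. Qed.

Definition total_edges i := \sum_(i <= j < N) d j * d j.+1.

Lemma total_edgesE i : total_edges i = d i * d i.+1 + total_edges i.+1.
Proof.
rewrite /total_edges; have [iN|Ni] := ltnP i N; first by rewrite big_ltn.
by rewrite !big_geq ?d_N // (leq_trans Ni).
Qed.

Section Orientation.
Variable n : nat -> nat.
Hypothesis n_le : forall i, n i <= d i.

(** The number of edges from layer i on if, in each layer j, the n j vertices
    marked as targets keep only incoming edges and the others only outgoing
    ones. *)
Definition oriented_edges i := \sum_(i <= j < N) (d j - n j) * n j.+1.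

Lemma oriented_edgesE i :
  oriented_edges i = (d i - n i) * n i.+1 + oriented_edges i.+1.
Proof.
rewrite /oriented_edges; have [iN|Ni] := ltnP i N; first by rewrite big_ltn.
by rewrite !big_geq ?d_N // (leq_trans Ni).
Qed.

(** Here u is twice the number of sources in layer i, which is prescribed
    instead of being d i - n i.  The left-hand side is linear in n i.+1, and
    the two values of the maximum correspond to the two extreme choices: all of
    layer i.+1 being targets, or all of it being sources. *)
Lemma oriented_edges_le i u :
  u * n i.+1 + 2 * oriented_edges i.+1
    <= total_edges i.+1 + d i.+1 * maxn u (d i).
Proof.
have [k] : exists k, N <= i + k by exists N; lia.
elim: k i u => [|k IHk] i u Ni.
  have := n_le i.+1; rewrite oriented_edgesE /oriented_edges big_geq ?d_N; lia.
have := IHk i.+1 (2 * (d i.+1 - n i.+1)); rewrite addSnnS => /(_ Ni).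
rewrite (oriented_edgesE i.+1) (total_edgesE i.+1).
have := n_le i.+1; have := d_mono i.
move: (d i) (d i.+1) (d i.+2) (n i.+1) (n i.+2) => d0 d1 d2 n1 n2.
move: (oriented_edges _) (total_edges _) => T R d20 n1d1 H.
have M0 : u <= maxn u d0 by lia.
have M1 : d0 <= maxn u d0 by lia.
move: (maxn u d0) M0 M1 => M M0 M1.
have h1 : u * n1 <= M * n1 by rewrite leq_mul2r M0 orbT.
case: (leqP (2 * (d1 - n1)) d1) => le1.
  have E1 : maxn (2 * (d1 - n1)) d1 = d1 by lia.
  rewrite E1 in H; have : M * n1 <= M * d1 by rewrite leq_mul2l n1d1 orbT.
  nia.
have E1 : maxn (2 * (d1 - n1)) d1 = 2 * (d1 - n1) by lia.
rewrite E1 in H.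
have : d2 * (d1 - 2 * n1) <= M * (d1 - 2 * n1).
  by rewrite leq_mul2r (leq_trans d20 M1) orbT.
nia.
Qed.

(** Equality in [oriented_edges_le]. *)
Definition extremal i u : Prop :=
  total_edges i.+1 + d i.+1 * maxn u (d i)
    <= u * n i.+1 + 2 * oriented_edges i.+1.

(** In the extremal case a nonempty layer consists only of targets or only of
    sources, because a linear function is maximal at an end point; in the
    second case nothing may be lost when passing from d i to d i.+2 either. *)
Lemma extremal_step i u : extremal i u -> 0 < d i.+1 -> 0 < maxn u (d i) ->
  [/\ d i <= u, n i.+1 = d i.+1 & extremal i.+1 0] \/
  [/\ u <= d i, n i.+1 = 0, d i.+2 = d i & extremal i.+1 (2 * d i.+1)].
Proof.
move=> ext d1_gt0 M_gt0.
have := oriented_edges_le i.+1 (2 * (d i.+1 - n i.+1)).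
move: ext; rewrite /extremal.
rewrite (oriented_edgesE i.+1) (total_edgesE i.+1).
have := n_le i.+1; have := d_mono i; move: d1_gt0 M_gt0.
move: (d i) (d i.+1) (d i.+2) (n i.+1) (n i.+2) => d0 d1 d2 n1 n2.
move: (oriented_edges _) (total_edges _) => T R d1_gt0 M_gt0 d20 n1d1 ext H.
have M0 : u <= maxn u d0 by lia.
have M1 : d0 <= maxn u d0 by lia.
have h1 : u * n1 <= maxn u d0 * n1 by rewrite leq_mul2r M0 orbT.
case: (leqP (2 * (d1 - n1)) d1) => le1.
  have E1 : maxn (2 * (d1 - n1)) d1 = d1 by lia.
  rewrite E1 in H.
  have h2 : d1 * maxn u d0 <= u * n1 by nia.
  have n1E : n1 = d1 by nia.
  left; split=> //; first by nia.
  by move: ext; rewrite n1E subnn max0n; nia.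
have E1 : maxn (2 * (d1 - n1)) d1 = 2 * (d1 - n1) by lia.
rewrite E1 in H.
have h3 : d2 * (d1 - 2 * n1) <= maxn u d0 * (d1 - 2 * n1).
  by rewrite leq_mul2r (leq_trans d20 M1) orbT.
have h4 : d1 * maxn u d0 <= u * n1 + d2 * (d1 - 2 * n1) by nia.
have n10 : n1 = 0 by nia.
right; split=> //; [nia|nia|].
by move: ext; rewrite n10 muln0 subn0 maxnE; nia.
Qed.

Lemma extremal_paired i u : extremal i u ->
  (d i < u -> paired i.+1) /\ (u < d i -> paired i).
Proof.
have [k] : exists k, N <= i + k by exists N; lia.
elim: k i u => [|k IHk] i u Ni ext.
  by split=> _; [apply: paired_empty | apply: paired_emptyS]; apply: d_N; lia.
have [d10|d1_gt0] := posnP (d i.+1).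
  by split=> _; [apply: paired_empty | apply: paired_emptyS].
have IH := IHk i.+1 _ _; rewrite addSnnS in IH.
split=> lt; case: (extremal_step ext d1_gt0) => [|[ui nd e']|[ui n0 d2 e']]; try lia.
- exact: (IH _ Ni e').2.
- apply: pairedS; first by right.
  by apply: (IH _ Ni e').1; lia.
Qed.

(** When half of layer i are sources, both extreme choices for the next layer
    are possible. *)
Lemma extremal_balanced i : extremal i (d i) -> 0 < d i -> 0 < d i.+1 ->
  (n i.+1 = d i.+1 /\ paired i.+1) \/ (n i.+1 = 0 /\ paired i).
Proof.
move=> ext d0 d1; case: (extremal_step ext d1) => [|[_ nd e']|[_ n0 d2 e']].
- by rewrite maxnn.
- by left; split=> //; apply: (extremal_paired e').2.
- right; split=> //; apply: pairedS; first by right.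
  by apply: (extremal_paired e').1; lia.
Qed.

(** Each dual pair of layer 0 contributes as a single source, so half of that
    layer are sources. *)
Lemma extremal_symplectic a0 :
  2 * a0 <= d 0 * n 1 ->
  total_edges 0 <= 2 * (a0 + oriented_edges 1) -> paired 0 \/ paired 1.
Proof.
move=> a0_le; rewrite total_edgesE => ext.
have [d0|d0] := posnP (d 0); first by left; apply: paired_empty.
have [d1|d1] := posnP (d 1); first by left; apply: paired_emptyS.
have e' : extremal 0 (d 0) by rewrite /extremal maxnn; nia.
by case: (extremal_balanced e' d0 d1) => -[_ ?]; [right | left].
Qed.

(** Here a0 is the number of edges leaving layer 0, and fix0 the number of
    self-dual vertices there.  Several targets in layer 1 reduce to the
    symplectic bound, up to the loss of fix0 * (n 1 - 2) due to the self-dual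
    vertices; a single target admits edges from all of layer 0, and balances
    layer 1 instead when d 1 = 2. *)
Lemma extremal_orthogonal a0 fix0 :
  d 1 != 1 -> (fix0 <= d 0) -> (n 1 = 0 -> a0 = 0) -> (n 1 = 1 -> a0 <= d 0) ->
  (2 <= n 1 -> 2 * a0 <= (d 0 - fix0) * n 1 + 2 * fix0) ->
  total_edges 0 <= 2 * (a0 + oriented_edges 1) ->
  [\/ paired 0, paired 1 /\ (fix0 = 0 \/ d 1 = 2) | d 1 = 2 /\ paired 2].
Proof.
move=> d1n1 fix_le a0_0 a0_1 a0_2; rewrite total_edgesE => ext.
have [d0|d0] := posnP (d 0); first by constructor 1; apply: paired_empty.
have [d1|d1] := posnP (d 1); first by constructor 1; apply: paired_emptyS.
case: (ltngtP (n 1) 1) => n1.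
- constructor 1; have n10 : n 1 = 0 by lia.
  have e' : extremal 0 0 by rewrite /extremal max0n (a0_0 n10) in ext *; nia.
  by apply: (extremal_paired e').2.
- have {}a0_2 := a0_2 n1.
  have fix_n : (d 0 - fix0) * n 1 + 2 * fix0 + fix0 * (n 1 - 2) = d 0 * n 1 by nia.
  have e' : extremal 0 (d 0) by rewrite /extremal maxnn; nia.
  case: (extremal_balanced e' d0 d1) => -[nE pE]; last by lia.
  constructor 2; split=> //.
  have := oriented_edges_le 0 (d 0); rewrite maxnn => le.
  have : fix0 * (n 1 - 2) = 0 by nia.
  by move/eqP; rewrite muln_eq0 => /orP[/eqP|/eqP ?]; [left | right; lia].
- have {}a0_1 := a0_1 n1; rewrite oriented_edgesE n1 in ext.
  rewrite total_edgesE in ext.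
  have le := oriented_edges_le 1 (2 * (d 1 - 1)).
  have maxE : maxn (2 * (d 1 - 1)) (d 1) = 2 * (d 1 - 1) by lia.
  have d20 := d_mono 0.
  have [d12|d12] := eqVneq (d 1) 2.
    have e' : extremal 1 (d 1) by rewrite /extremal maxnn; nia.
    have [d2|d2] := posnP (d 2); first by constructor 2; split; [exact: paired_emptyS | right].
    case: (extremal_balanced e' d1 d2) => -[_ ?]; first by constructor 3.
    by constructor 2; split=> //; right.
  have d02 : d 0 = d 2 by rewrite maxE in le; nia.
  have e' : extremal 1 (2 * (d 1 - 1)) by rewrite /extremal maxE; nia.
  constructor 1; apply: pairedS; first by right.
  by apply: (extremal_paired e').1; lia.
Qed.

End Orientation.
End Numeric.

Section PairedSum.
Variables (d : nat -> nat) (N : nat).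
Hypothesis d_N : forall i, N <= i -> d i = 0.

(** Taking all the edges of every other pair of consecutive layers gives half of
    the edges when the numbers of edges are equal in pairs. *)
Lemma paired_sum (f : nat -> nat) i : paired d i ->
  (forall j, N <= j -> f j = 0) -> (forall k, f (i + 2 * k) = 0) ->
  (forall k, f (i + 2 * k).+1 = d (i + 2 * k).+1 * d (i + 2 * k).+2) ->
  2 * \sum_(i <= j < N) f j = total_edges d N i.
Proof.
move=> pi fN f0 f1; have [k] : exists k, N <= i + k by exists N; lia.
elim/ltn_ind: k i pi f0 f1 => k IHk i pi f0 f1 Nk.
have sumE j : \sum_(j <= l < N) f l = f j + \sum_(j.+1 <= l < N) f l.
  have [jN|Nj] := ltnP j N; first by rewrite big_ltn.
  by rewrite !big_geq ?fN // (leq_trans Nj).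
have f00 := f0 0; have f10 := f1 0; rewrite muln0 addn0 in f00 f10.
have [Ni|iN] := leqP N i.
  by rewrite /total_edges !big_geq.
rewrite (sumE i) (sumE i.+1) (total_edgesE d_N i) (total_edgesE d_N i.+1) f00 f10.
have shift k' : i.+2 + 2 * k' = i + 2 * k'.+1 by lia.
have IH : 2 * \sum_(i.+2 <= j < N) f j = total_edges d N i.+2.
  apply: (IHk (k - 2)); first by lia.
  - by move=> k'; rewrite shift; apply: pi.
  - by move=> k'; rewrite shift; apply: f0.
  - by move=> k'; rewrite shift; apply: f1.
  - by lia.
have := pi 0; rewrite muln0 addn0; move: IH.
move: (\sum_(_ <= _ < _) _) (total_edges _ _ _) => s t; nia.
Qed.

End PairedSum.

(** * Partitions *)

Definition parity_first (b : bool) (s : seq nat) : Prop :=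
  {in s &, forall x y, odd x = b -> odd y != b -> x < y}.

Fixpoint changes (a : nat) (s : seq nat) : nat :=
  if s is b :: s' then (odd a != odd b) + changes b s' else 0.

Lemma parity_changesE a s p : distinct_parts p = a :: s ->
  parity_changes p = changes a s.
Proof.
rewrite /parity_changes => -> /=.
elim: s a => //= b s IHs a; by rewrite IHs.
Qed.

Lemma changes_eq0 a s : changes a s = 0 <-> {in s, forall x, odd x = odd a}.
Proof.
elim: s a => //= b s IHs a; split.
  case: eqVneq => //= ab /IHs sb x; rewrite inE => /orP[/eqP -> //|/sb ->].
  by rewrite ab.
move=> sa; have ba : odd b = odd a by apply: sa; rewrite mem_head.
rewrite ba eqxx add0n; apply/IHs => x xs; rewrite ba; apply: sa.
by rewrite inE xs orbT.
Qed.

(** In an increasing sequence the first parity is that of the head, and a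
    single change means that it does not come back. *)
Lemma changes_le1 a s : path ltn a s ->
  changes a s <= 1 <-> parity_first (odd a) (a :: s).
Proof.
elim: s a => [|b s IHs] a /=.
  by move=> _; split=> // _ x y; rewrite !inE => /eqP -> /eqP ->; rewrite eqxx.
move=> /andP[ab bs].
have lt_a x : x \in b :: s -> a < x.
  rewrite inE => /orP[/eqP -> //|xs]; apply: ltn_trans ab _.
  by have /allP := order_path_min ltn_trans bs; apply.
have lt_b x : x \in s -> b < x.
  by have /allP := order_path_min ltn_trans bs; apply.
have [ba|ba] := eqVneq (odd a) (odd b).
  rewrite add0n; apply: iff_trans (IHs _ bs) _; rewrite -ba; split=> [pf x y|pf x y xs ys].
    rewrite [x \in _]inE [y \in _]inE => /orP[/eqP ->|xs] /orP[/eqP ->|ys].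
    - by rewrite eqxx.
    - by move=> _ _; apply: lt_a.
    - by rewrite eqxx.
    - exact: pf.
  by apply: pf; rewrite inE ?xs ?ys orbT.
rewrite add1n ltnS leqn0; split=> [/eqP/changes_eq0 sb x y|pf].
  rewrite [x \in _]inE [y \in _]inE => /orP[/eqP ->|xs] /orP[/eqP ->|ys].
  - by rewrite eqxx.
  - by move=> _ _; apply: lt_a.
  - by rewrite eqxx.
  - move=> xa; move: xs ba; rewrite inE -xa => /orP[/eqP ->|/sb ->]; by rewrite eqxx.
apply/eqP/changes_eq0 => x xs; apply/eqP; apply: contraT => xb.
have : x < b.
  apply: pf; rewrite ?inE ?eqxx ?xs ?orbT //; last by rewrite eq_sym.
  by move: xb ba; case: (odd x); case: (odd a); case: (odd b).
by have := lt_b _ xs; lia.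
Qed.

(** If the head has the parity that should come last, then the other parity does
    not occur at all. *)
Lemma changes_parity_first b a s : path ltn a s ->
  parity_first b (a :: s) -> changes a s <= 1.
Proof.
move=> pas pf; apply/changes_le1 => //.
have [->|ab] := eqVneq (odd a) b; first by [].
move=> x y xs ys xa ya; exfalso.
have lea z : z \in a :: s -> a <= z.
  rewrite inE => /orP[/eqP -> //|zs].
  by have /allP/(_ _ zs)/ltnW := order_path_min ltn_trans pas.
have : y < a; last by have := lea _ ys; lia.
apply: pf; rewrite ?mem_head //.
by move: ya ab; case: (odd y); case: (odd a); case: b.
Qed.

Section ParityChanges.
Variable p : seq nat.

Let mem_dp x : (x \in distinct_parts p) = (x \in p).
Proof. by rewrite mem_sort mem_undup. Qed.

Let dp_sorted : sorted ltn (distinct_parts p).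
Proof.
rewrite ltn_sorted_uniq_leq sort_uniq undup_uniq /=.
by apply: sort_sorted; apply: leq_total.
Qed.

Lemma parity_changes_eq0 : parity_changes p = 0 <-> {in p &, forall x y, odd x = odd y}.
Proof.
case E: (distinct_parts p) => [|a s].
  rewrite /parity_changes E; split=> // _ x y.
  by rewrite -mem_dp E.
rewrite (parity_changesE E); apply: iff_trans (changes_eq0 _ _) _; split=> [sa x y|pa x xs].
  rewrite -!mem_dp E !inE => /orP[/eqP ->|/sa ->] /orP[/eqP ->|/sa ->] //.
by apply: pa; rewrite -mem_dp E inE ?eqxx ?xs ?orbT.
Qed.

Lemma parity_changes_le1 :
  parity_changes p <= 1 <-> parity_first false p \/ parity_first true p.
Proof.
case E: (distinct_parts p) => [|a s].
  rewrite /parity_changes E; split=> // _; left=> x y.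
  by rewrite -mem_dp E.
have pE b : parity_first b (a :: s) <-> parity_first b p.
  by split=> pf x y xs ys; apply: pf; rewrite ?E -?mem_dp ?E // -E mem_dp.
have pas : path ltn a s by have := dp_sorted; rewrite E.
rewrite (parity_changesE E); split=> [/(changes_le1 pas)|].
  by case: (odd a) => /pE; [right | left].
by case=> /pE; apply: changes_parity_first.
Qed.

(** Once the smallest part is removed, which may be 1, the even part precedes all
    the odd ones. *)
Lemma parity_changes_ones : 0 \notin p -> kind_ones_even_odd p ->
  parity_changes p <= 2.
Proof.
move=> p0 [k [l [kl _ pk]]].
case E: (distinct_parts p) => [|a s]; first by rewrite /parity_changes E.
have pas : path ltn a s by have := dp_sorted; rewrite E.
have sp x : x \in a :: s -> x \in p by rewrite -E mem_dp.
have a_gt0 : 0 < a by rewrite lt0n; apply: contraNneq p0 => <-; apply/sp/mem_head.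
rewrite (parity_changesE E); case: s pas sp {E} => //= b s /andP[ab bs] sp.
suff : changes b s <= 1 by case: eqP => /=; lia.
apply: (@changes_parity_first false) => // x y xs ys xe yo.
have b_le z : z \in b :: s -> b <= z.
  rewrite inE => /orP[/eqP -> //|zs].
  by have /allP/(_ _ zs)/ltnW := order_path_min ltn_trans bs.
have {}yo : odd y by move: yo; case: (odd y).
have := pk x (sp x _); rewrite xe => /(_ _)/eqP ->; last by rewrite inE xs orbT.
have := pk y (sp y _); rewrite yo inE ys orbT => /(_ isT)/orP[/eqP y1|]; last by lia.
by have := b_le y ys; lia.
Qed.

End ParityChanges.

Lemma largest_part_max p x : x \in p -> x <= largest_part p.
Proof. by move=> xp; apply: leq_bigmax_seq. Qed.

Lemma largest_part_mem p x : x \in p -> largest_part p \in p.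
Proof.
case: p => [|a p] //; rewrite /largest_part => _ {x}.
elim: p a => [|b p IHp] a; first by rewrite big_seq1 mem_head.
have := IHp b; rewrite [in X in _ -> X]big_cons inE.
set m := \max_(j <- b :: p) j => mp.
by rewrite /maxn; case: ifP => _; rewrite ?mem_head // !inE mp orbT.
Qed.

Lemma exists_max_part (P : pred nat) (p : seq nat) : exists m,
  {in p, forall x, P x -> x <= m} /\ (m = 0 \/ m \in p /\ P m).
Proof.
elim: p => [|a p [m [mP m_in]]]; first by exists 0; split=> //; left.
have [/andP[Pa ma]|nma] := boolP (P a && (m <= a)).
  exists a; split; last by right; rewrite mem_head.
  by move=> x; rewrite inE => /orP[/eqP -> //|/mP le /le xm]; apply: leq_trans ma.
exists m; split=> [x|].
  rewrite inE => /orP[/eqP -> Pa|/mP //].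
  by move: nma; rewrite Pa /=; lia.
by case: m_in => [|[mp Pm]]; [left | right; rewrite inE mp orbT].
Qed.

Section Listed.
Variables (p : seq nat).

Lemma kind_even_oddP : kind_even_odd p <-> parity_first false p.
Proof.
split=> [[k [l [kl pk]]] x y xp yp xe yo|pf].
  have {}yo : odd y by move: yo; case: (odd y).
  by have := pk _ xp; have := pk _ yp; rewrite yo xe; lia.
have [m [mP m_in]] := exists_max_part (fun x => ~~ odd x) p.
have m_even : ~~ odd m by case: m_in => [->|[]].
exists m./2, m./2; split=> // j jp; case: ifPn => jo; last by have := mP _ jp jo; lia.
suff : m < j by lia.
case: m_in => [->|[mp _]]; first by case: (j) jo.
by apply: pf => //; rewrite ?jo //; apply/negbTE.
Qed.

Lemma kind_odd_evenP : kind_odd_even p <-> parity_first true p.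
Proof.
split=> [[k [l [kl pk]]] x y xp yp xo ye|pf].
  have {}ye : odd y = false by move: ye; case: (odd y).
  by have := pk _ xp; have := pk _ yp; rewrite xo ye; lia.
have [m [mP m_in]] := exists_max_part odd p.
exists (uphalf m), (uphalf m); split=> // j jp; case: ifPn => je.
  case: m_in => [m0|[mp mo]]; have := mP _ jp je; last by lia.
  by case: (j) je m0 => //=; lia.
case: m_in => [->|[mp mo]] //.
have : m < j by apply: pf => //; case: (odd j) je.
by lia.
Qed.

Lemma kind_odd_top_evenP : kind_odd_top_even p <->
  parity_first true p /\ exists2 j, unique_even_part p j & count_mem j p = 2.
Proof.
split=> [[k [l [kl cnt pk]]]|[/kind_odd_evenP[k [l [kl pk]]] [j [jp je ju] cnt]]].
  split; first by apply/kind_odd_evenP; exists k, l; split=> // j /pk; case: ifP => // _ /eqP ->.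
  exists (2 * l) => //; split.
  - by rewrite -has_pred1 has_count cnt.
  - by lia.
  - by move=> i /pk; case: (odd i) => // /eqP.
exists k, j./2; have jE : 2 * j./2 = j by lia.
rewrite jE; split=> // [|i ip].
  by have := pk _ jp; rewrite (negPf je); lia.
have := pk _ ip; case: ifPn => // ie _.
by rewrite (ju _ ip ie).
Qed.

Lemma kind_ones_even_oddP : kind_ones_even_odd p <->
  exists j, [/\ unique_even_part p j, count_mem j p = 2
    & {in p, forall x, odd x -> x = 1 \/ j < x}].
Proof.
split=> [[k [l [kl cnt pk]]]|[j [[jp je ju] cnt pj]]].
  exists (2 * k); split=> //; first split.
  - by rewrite -has_pred1 has_count cnt.
  - by lia.
  - by move=> i /pk; case: (odd i) => // /eqP.
  - by move=> x /pk; case: (odd x) => // /orP[/eqP|] ? _; [left | right; lia].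
have jE : 2 * j./2 = j by lia.
exists j./2, j./2; rewrite jE; split=> // i ip; case: ifPn => [io|ie].
  by have [->|] := pj _ ip io; rewrite ?eqxx // => ji; apply/orP; right; lia.
by rewrite (ju _ ip ie).
Qed.

(** The largest part would have to be smaller than any part of the other parity. *)
Lemma parity_first_max b : parity_first b p -> odd (largest_part p) = b ->
  parity_changes p = 0.
Proof.
move=> pf Lb; suff pb : {in p, forall y, odd y = b}.
  by apply/parity_changes_eq0 => x y /pb -> /pb ->.
move=> y yp; apply/eqP; apply: contraT => yb.
by have := pf _ _ (largest_part_mem yp) yp Lb yb; have := largest_part_max yp; lia.
Qed.

Hypothesis p0 : 0 \notin p.

(** A sequence with at most one parity change has all parts of one parity before
    the others, and the parity of the largest part tells which; two changes are
    only allowed for parts 1, one even part, and larger odd parts. *)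
Lemma partition_conditionP X : partition_condition X p <-> listed_partition X p.
Proof.
have le1P := parity_changes_le1 p.
have even_top : parity_changes p <= 1 -> ~~ odd (largest_part p) ->
    parity_first true p.
  move=> /le1P[pf|//] Le.
  have := parity_first_max pf (negbTE Le) => /parity_changes_eq0 same x y xp yp xo.
  by rewrite (same _ _ yp xp) xo.
have odd_top : parity_changes p <= 1 -> odd (largest_part p) ->
    parity_first false p.
  move=> /le1P[//|pf] Lo.
  have := parity_first_max pf Lo => /parity_changes_eq0 same x y xp yp xo.
  by rewrite (same _ _ yp xp) xo.
have ones : X <> TypeC -> kind_ones_even_odd p -> partition_condition X p.
  move=> XC kp; have le2 := parity_changes_ones p0 kp.
  have /kind_ones_even_oddP[j [uj cnt pj]] := kp; have [jp je ju] := uj.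
  have Le_j : ~~ odd (largest_part p) -> largest_part p = j.
    by move=> Le; apply: ju (largest_part_mem jp) Le.
  have Le_pf : ~~ odd (largest_part p) -> parity_changes p <= 1.
    move=> Le; apply/le1P; right => x y xp yp xo ye.
    have {}ye : ~~ odd y by case: (odd y) ye.
    have := largest_part_max xp; rewrite (Le_j Le) (ju _ yp ye) => xj.
    by rewrite ltn_neqAle xj andbT; apply: contraNneq je => <-.
  suff main : 1 <= parity_changes p -> (~~ odd (largest_part p) ->
         parity_changes p = 1 /\
         (X = TypeB ->
            unique_even_part p (largest_part p) /\
            count_mem (largest_part p) p = 2)) /\
      (parity_changes p = 2 ->
         odd (largest_part p) /\
         exists j : nat,
           [/\ unique_even_part p j, count_mem j p = 2
             & forall i : nat, i \in p -> (i < j) -> i = 1]).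
    by case: X XC main.
  move=> ge1; split=> [Le|eq2].
    by split=> [|_]; [have := Le_pf Le; lia | rewrite Le_j].
  split; first by apply: contraT => /Le_pf; rewrite eq2.
  exists j; split=> // i ip ij; have [ie|ie] := boolP (odd i).
    by have [] := pj _ ip ie; lia.
  by have := ju _ ip ie; lia.
have C_D : partition_condition X p -> X <> TypeC ->
    parity_changes p <= 1 \/ kind_ones_even_odd p.
  move=> cond XC; have {cond} : parity_changes p <= 2 /\
      (parity_changes p = 2 -> exists j : nat,
           [/\ unique_even_part p j, count_mem j p = 2
             & forall i : nat, i \in p -> (i < j) -> i = 1]).
    by case: X XC cond {ones} => // _ [le2 cond]; split=> // eq2;
      case: cond => [|_ /(_ eq2)[]]; rewrite ?eq2.
  case=> le2 eq2; have [|gt1] := leqP (parity_changes p) 1; first by left.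
  right; have [|j [uj cnt pj]] := eq2; first by lia.
  apply/kind_ones_even_oddP; exists j; split=> // x xp xo.
  have [] := ltngtP x j; [by left; apply: pj | by right |].
  by move=> xj; case: uj => _; rewrite -xj xo.
have eo : X <> TypeC -> parity_first false p -> partition_condition X p.
  move=> XC pf; have le1 : parity_changes p <= 1 by apply/le1P; left.
  have Lo : 1 <= parity_changes p -> odd (largest_part p).
    move=> ge1; apply: contraLR ge1 => Le.
    by rewrite (parity_first_max pf (negbTE Le)).
  by case: X XC {ones C_D} => [_|[]//|_]; (split; first by lia);
    move=> /Lo ->; split=> //; lia.
have oe : parity_first true p -> parity_changes p <= 1 /\
    (1 <= parity_changes p -> parity_changes p = 1 /\ ~~ odd (largest_part p)).
  move=> pf; have le1 : parity_changes p <= 1 by apply/le1P; right.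
  split=> // ge1; split; first by lia.
  apply: contraL ge1 => Lo; by rewrite (parity_first_max pf Lo).
have same_eo : parity_changes p = 0 -> kind_even_odd p.
  move=> /parity_changes_eq0 same; apply/kind_even_oddP => x y xp yp xe.
  by rewrite (same _ _ yp xp) xe.
case: X ones C_D eo => ones C_D eo; split.
- move=> cond; have [|le1|] := C_D cond; [by [] | | by constructor 3; split; [left|]].
  have [Lo|Le] := boolP (odd (largest_part p)).
    by constructor 1; apply/kind_even_oddP/odd_top.
  have [/same_eo|ge1] := posnP (parity_changes p); first by constructor 1.
  constructor 4; split=> //; apply/kind_odd_top_evenP; split; first exact: even_top.
  by have [_ /(_ erefl)[uj cnt]] := (cond.2 ge1).1 Le; exists (largest_part p).
- case=> [/kind_even_oddP|[[]//]|[_]|[_ /kind_odd_top_evenP[pf [j uj cnt]]]].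
  + exact: eo.
  + exact: ones.
  have [le1 ge] := oe pf; split; first by lia.
  move=> /ge[-> Le]; split=> // _; split=> // _.
  have [jp je ju] := uj; have Lj : largest_part p = j.
    exact: ju (largest_part_mem jp) Le.
  by rewrite Lj.
- by move=> /le1P[/kind_even_oddP|/kind_odd_evenP]; [constructor 1 | constructor 2; split; [left|]].
- case=> [/kind_even_oddP|[_ /kind_odd_evenP]|[[]//]|[]//] pf; apply/le1P; by [left | right].
- move=> cond; have [|le1|] := C_D cond; [by [] | | by constructor 3; split; [right|]].
  have /le1P[/kind_even_oddP|/kind_odd_evenP] := le1; first by constructor 1.
  by constructor 2; split; [right|].
- case=> [/kind_even_oddP|[_ /kind_odd_evenP pf]|[_]|[]//].
  + exact: eo.
  + have [le1 ge] := oe pf; split; first by lia.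
    by move=> /ge[-> Le]; split=> // _; split.
  + exact: ones.
Qed.

End Listed.

(** The dimension of the i-th weight space of h: a Jordan block of size x has the
    weights x - 1, x - 3, ..., 1 - x. *)
Definition weight_dim (p : seq nat) (i : nat) : nat :=
  count (fun x => (i < x) && (odd x != odd i)) p.

Section WeightDim.
Variable p : seq nat.
Local Notation W := (weight_dim p).

Lemma weight_dim_mono i : W i.+2 <= W i.
Proof. by apply: sub_count => x /=; rewrite negbK => /andP[ix ->]; rewrite andbT; lia. Qed.

Lemma weight_dim_eq0 i : largest_part p <= i -> W i = 0.
Proof.
move=> Li; apply/eqP; rewrite -leqn0 leqNgt -has_count; apply/hasPn => x xp.
by have := largest_part_max xp; lia.
Qed.

(** The difference W i - W i.+2 is the multiplicity of i.+1, and W i.+1 counts the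
    parts above i.+1 of the parity of i. *)
Lemma paired_weight_dim i : paired W i <->
  {in p &, forall x y, i < x -> odd x != odd i -> odd y = odd i -> y < x}.
Proof.
split=> [pi x y xp yp ix xi yi|ord k].
  have xE : x = (i + 2 * (x - i).-1./2).+1 by lia.
  have [|] := pi (x - i).-1./2; rewrite /weight_dim.
    rewrite -xE; move/eqP; rewrite -leqn0 leqNgt -has_count => /hasPn/(_ y yp).
    by rewrite yi eq_sym xi andbT; have := xE; case: (ltngtP x y) => // xy; rewrite xy yi eqxx in xi.
  set q := i + 2 * (x - i).-1./2 in xE *; move=> E; exfalso; move: E.
  have -> : count (fun x => (q < x) && (odd x != odd q)) p =
      count (fun x => (q.+2 < x) && (odd x != odd q.+2)) p + count_mem x p.
    rewrite -count_predUI [X in _ = _ + X](eq_count (a2 := pred0)) ?count_pred0 ?addn0.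
      by apply: eq_count => z /=; case: (eqVneq z x) => [->|]; lia.
    by move=> z /=; case: (eqVneq z x) => [->|]; lia.
  have : 0 < count_mem x p by rewrite -has_count has_pred1.
  lia.
set x := (i + 2 * k).+1; have [xp|xp] := boolP (x \in p); [left | right].
  apply/eqP; rewrite -leqn0 leqNgt -has_count; apply/hasPn => y yp.
  apply/negP => /andP[xy yx]; have := ord _ _ xp yp; rewrite /x in xy yx *; lia.
apply: eq_in_count => z zp /=.
have : z != x by apply: contraNneq xp => <-.
rewrite /x; lia.
Qed.

Lemma paired0P : paired W 0 <-> parity_first false p.
Proof.
rewrite paired_weight_dim; split=> ord x y xp yp.
  by move=> xe yo; apply: (ord y x) => //; case: (y) yo.
by move=> _ xo ye; apply: (ord y x).
Qed.

Hypothesis p0 : 0 \notin p.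

Lemma paired1P : paired W 1 <-> parity_first true p.
Proof.
rewrite paired_weight_dim; split=> ord x y xp yp.
  move=> xo ye; apply: (ord y x) => //.
  have : y != 0 by apply: contraNneq p0 => <-.
  by move: ye; case: y {yp} => [|[]].
by move=> _ xe yo; apply: (ord y x).
Qed.

Lemma weight_dim1 : W 1 = count (fun x => ~~ odd x) p.
Proof.
apply: eq_in_count => x xp; have : x != 0 by apply: contraNneq p0 => <-.
by case: x {xp} => [|[]] //= n _; case: (odd n).
Qed.

Lemma unique_even_weight_dim j : unique_even_part p j ->
  W 1 = count_mem j p.
Proof.
case=> jp je ju; rewrite weight_dim1; apply: eq_in_count => x xp /=.
by apply/idP/eqP => [/(ju _ xp)|->].
Qed.

(** Two even parts occur.  If they were different, exactly one part would exceed
    b - 1 with the parity of b, where b is the larger one, so that W (b - 1) = 1. *)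
Lemma weight_dim1_unique : (forall i, odd i -> W i != 1) -> W 1 = 2 ->
  exists2 j, unique_even_part p j & count_mem j p = 2.
Proof.
move=> Wodd W1.
have : size (filter (fun x => ~~ odd x) p) = 2 by rewrite size_filter -weight_dim1.
case E: (filter _ p) => [|a [|b []]] //= _.
have memE x : (x \in p) && ~~ odd x = (x == a) || (x == b).
  by have := mem_filter (fun x => ~~ odd x) x p; rewrite E !inE => ->; rewrite andbC.
have /andP[ap ae] : (a \in p) && ~~ odd a by rewrite memE eqxx.
have /andP[bp be] : (b \in p) && ~~ odd b by rewrite memE eqxx orbT.
have cntE (P : pred nat) : count (fun x => P x && ~~ odd x) p = P a + P b.
  by rewrite -count_filter E /= addn0.
have [ab|ab] := eqVneq a b.
  exists a; first by split=> // i ip ie; have := memE i; rewrite ip ie -ab orbb => /esym/eqP.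
  have <- : count (fun x => pred1 a x && ~~ odd x) p = 2 by rewrite cntE -ab /= eqxx.
  by apply: eq_count => x /=; case: eqP => // ->; rewrite ae.
have lem y : 0 < y -> ~~ odd y -> count (fun z => (y <= z) && ~~ odd z) p != 1.
  move=> y0 ye; rewrite (_ : count _ p = W y.-1); first by apply: Wodd; lia.
  by apply: eq_count => z; lia.
exfalso; case: (ltngtP a b) ab => // lt _.
  have b0 : 0 < b by lia.
  have ba : (b <= a) = false by lia.
  by have := lem b b0 be; rewrite cntE leqnn ba.
have a0 : 0 < a by lia.
have ab' : (a <= b) = false by lia.
by have := lem a a0 ae; rewrite cntE leqnn ab'.
Qed.

Lemma paired2P j : unique_even_part p j ->
  paired W 2 <-> {in p, forall x, odd x -> x = 1 \/ j < x}.
Proof.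
case=> jp je ju; rewrite paired_weight_dim; split=> [ord x xp xo|ord x y xp yp x2 xo ye].
  have [->|x1] := eqVneq x 1; first by left.
  right; apply: ord => //; [by case: x {xp} xo x1 => [|[|[]]] | by rewrite xo | exact/negbTE].
have xo' : odd x by move: xo; case: (odd x).
rewrite (ju _ yp) ?ye //; case: (ord _ xp xo') => //; lia.
Qed.

Lemma listed_symplectic : listed_partition TypeC p <-> paired W 0 \/ paired W 1.
Proof.
split=> [[/kind_even_oddP|[_ /kind_odd_evenP]|[[]//]|[]//]|].
- by move=> ?; left; apply/paired0P.
- by move=> ?; right; apply/paired1P.
case=> [/paired0P/kind_even_oddP|/paired1P/kind_odd_evenP]; first by constructor 1.
by constructor 2; split; [left|].
Qed.

Hypothesis W_odd : forall i, odd i -> W i != 1.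

Lemma kind_onesW : kind_ones_even_odd p <-> W 1 = 2 /\ paired W 2.
Proof.
split=> [/kind_ones_even_oddP[j [uj cnt pj]]|[W12 p2]]; last apply/kind_ones_even_oddP.
  by rewrite (unique_even_weight_dim uj); split=> //; apply/(paired2P uj).
have [j uj cnt] := weight_dim1_unique W_odd W12.
by exists j; split=> //; apply/(paired2P uj).
Qed.

Lemma kind_odd_topW : kind_odd_top_even p <-> W 1 = 2 /\ paired W 1.
Proof.
split=> [/kind_odd_top_evenP[/paired1P pf [j uj cnt]]|[W12 /paired1P pf]].
  by rewrite (unique_even_weight_dim uj).
by apply/kind_odd_top_evenP; split=> //; apply: weight_dim1_unique.
Qed.

(** In type D the third kind needs W 1 = 2 to express that the even part is unique
    of multiplicity 2; in the other two kinds multiplicities do not matter. *)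
Lemma listed_even_orthogonal : listed_partition TypeD p <->
  [\/ paired W 0, paired W 1 | W 1 = 2 /\ paired W 2].
Proof.
split.
  case=> [/kind_even_oddP/paired0P|[_ /kind_odd_evenP/paired1P]|[_ /kind_onesW]|[]//].
  - by constructor 1.
  - by constructor 2.
  - by constructor 3.
case=> [/paired0P/kind_even_oddP|/paired1P/kind_odd_evenP|/kind_onesW]; first by constructor 1.
  by constructor 2; split; [right|].
by constructor 3; split; [right|].
Qed.

Lemma listed_odd_orthogonal : listed_partition TypeB p <->
  [\/ paired W 0, W 1 = 2 /\ paired W 1 | W 1 = 2 /\ paired W 2].
Proof.
split.
  case=> [/kind_even_oddP/paired0P|[[]//]|[_ /kind_onesW]|[_ /kind_odd_topW]].
  - by constructor 1.
  - by constructor 3.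
  - by constructor 2.
case=> [/paired0P/kind_even_oddP|/kind_odd_topW|/kind_onesW]; first by constructor 1.
  by constructor 4.
by constructor 3; split; [left|].
Qed.

End WeightDim.

Import Order.TTheory GRing.Theory Num.Theory.
Local Open Scope ring_scope.

(** * Finite families of vectors *)

Section Families.
Variables (F : fieldType) (vT : vectType F).
Implicit Types (U : {vspace vT}).

Definition free_family (I : finType) (x : I -> vT) : Prop :=
  forall c : I -> F, \sum_a c a *: x a = 0 -> forall a, c a = 0.

Definition spanning_family (I : finType) (x : I -> vT) : Prop :=
  forall u : vT, exists c : I -> F, u = \sum_a c a *: x a.

Lemma free_enum_family (I : finType) (x : I -> vT) (J : {pred I}) :
  (forall c : I -> F, \sum_(a in J) c a *: x a = 0 ->
     {in J, forall a, c a = 0}) ->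
  free [tuple x (enum_val i) | i < #|J|].
Proof.
move=> freex; apply/freeP => k k0 i; pose c a := \sum_(j | enum_val j == a) k j.
have cE j : c (enum_val j) = k j.
  by rewrite /c (big_pred1 j) // => l; rewrite (inj_eq enum_val_inj).
rewrite -cE; apply: freex (enum_valP i).
rewrite big_enum_val -[RHS]k0; apply: eq_bigr => j _.
by rewrite cE -tnth_nth tnth_mktuple.
Qed.

Lemma dimv_family (I : finType) (x : I -> vT) U (J : {pred I}) :
  {in J, forall a, x a \in U} ->
  (forall u, u \in U -> exists c : I -> F, u = \sum_(a in J) c a *: x a) ->
  (forall c : I -> F, \sum_(a in J) c a *: x a = 0 ->
     {in J, forall a, c a = 0}) ->
  \dim U = #|J|.
Proof.
move=> xU spanU /free_enum_family freeX.
suffices /size_basis -> : basis_of U [tuple x (enum_val i) | i < #|J|] by [].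
rewrite /basis_of freeX andbT eqEsubv; apply/andP; split; last first.
  apply/subvP => u /spanU[c ->]; rewrite big_enum_val; apply: memv_suml => i _.
  apply/memvZ/memv_span/tnthP; exists i.
  by rewrite tnth_mktuple.
by apply/span_subvP => _ /tnthP[i ->]; rewrite tnth_mktuple; apply/xU/enum_valP.
Qed.

(** Kernels, weight spaces and the like are all spanned by part of a basis; this
    turns their dimensions into cardinals. *)
Lemma dimv_coord_support (I : finType) (x : I -> vT) U (J : {pred I}) :
  free_family x -> spanning_family x ->
  (forall c : I -> F,
     \sum_a c a *: x a \in U <-> forall a, a \notin J -> c a = 0) ->
  \dim U = #|J|.
Proof.
move=> freex spanx UJ; apply: (@dimv_family I x).
- move=> a aJ; rewrite -[x a]scale1r -(big_pred1_eq +%R a (fun b => 1 *: x b)).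
  rewrite big_mkcond (eq_bigr (fun b => (b == a)%:R *: x b)).
    by apply/UJ => b; case: eqP => // ->; rewrite aJ.
  by move=> b _; case: eqP => _ //; rewrite scale0r.
- move=> u; have [c ->] := spanx u; move/UJ => c0; exists c.
  rewrite [RHS]big_mkcond; apply: eq_bigr => a _.
  by case: ifPn => // /c0 ->; rewrite scale0r.
- move=> c c0 a aJ.
  have := freex (fun b => if b \in J then c b else 0) _ a; rewrite aJ; apply.
  rewrite -[RHS]c0 [RHS]big_mkcond; apply: eq_bigr => b _.
  by case: ifP => // _; rewrite scale0r.
Qed.

Lemma card_basis_family (I : finType) (x : I -> vT) :
  free_family x -> spanning_family x -> #|I| = \dim {: vT}.
Proof.
move=> freex spanx; apply/esym/(dimv_coord_support freex spanx) => c.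
by rewrite memvf; split=> // _ a; rewrite inE.
Qed.

Lemma card_free_family (I : finType) (x : I -> vT) :
  free_family x -> (#|I| <= \dim {: vT})%N.
Proof.
move=> freex.
have /free_enum_family : forall c : I -> F,
    \sum_(a in I) c a *: x a = 0 -> {in I, forall a, c a = 0}.
  by move=> c c0 a _; apply: freex.
by move/eqP; rewrite size_tuple => <-; apply/dimvS/subvf.
Qed.

Lemma free_subseq (s : seq vT) :
  exists t, [/\ {subset t <= s}, free t & <<t>>%VS = <<s>>%VS].
Proof.
elim: s => [|u s [t [ts freet tE]]]; first by exists [::]; rewrite nil_free.
have [u_t|u_t] := boolP (u \in <<t>>%VS).
  exists t; split=> //; first by move=> y /ts; rewrite inE orbC => ->.
  by rewrite span_cons -tE; apply/esym/addv_idPr; rewrite -memvE.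
exists (u :: t); split; first 1 last.
- by rewrite free_cons u_t.
- by rewrite !span_cons tE.
by move=> y; rewrite !inE => /orP[->//|/ts ->]; rewrite orbT.
Qed.

End Families.

(** * Representations of sl_2 *)

Lemma mulmxXS (F : fieldType) n m (a : 'M[F]_n) k (x : 'M[F]_(n, m)) :
  a ^+ k.+1 *m x = a *m (a ^+ k *m x).
Proof. by rewrite exprS mulmxA. Qed.

Lemma mulmxXSr (F : fieldType) n m (a : 'M[F]_n) k (x : 'M[F]_(n, m)) :
  a ^+ k.+1 *m x = a ^+ k *m (a *m x).
Proof. by rewrite exprSr mulmxA. Qed.

Lemma mulmxX0 (F : fieldType) n m (a : 'M[F]_n) (x : 'M[F]_(n, m)) :
  a ^+ 0 *m x = x.
Proof. by rewrite expr0 mul1mx. Qed.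

(** The powers of f are eigenvectors of ad h for distinct eigenvalues, and
    ad h has only finitely many eigenvalues. *)
Lemma ad_eigenvector_nilpotent (F : numFieldType) n (h f : 'M[F]_n) (c : F) :
  c != 0 -> lie_bracket h f = c *: f -> exists N, f ^+ N = 0.
Proof.
move=> c0 hf; pose L := lin_mx (weight_defect h 0).
have hfX k : lie_bracket h (f ^+ k) = (c * k%:R) *: f ^+ k.
  elim: k => [|k IHk].
    by rewrite expr0 mulr0 scale0r /lie_bracket mulmx1 mul1mx subrr.
  have -> : lie_bracket h (f ^+ k.+1)
      = lie_bracket h (f ^+ k) *m f + f ^+ k *m lie_bracket h f.
    by rewrite exprSr /lie_bracket mulmxBl mulmxBr !mulmxA addrA subrK.
  rewrite IHk hf -scalemxAl -scalemxAr -scalerDl exprSr.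
  by rewrite -{2}[c]mulr1 -mulrDr -natr1.
have [/existsP[k /eqP fk0]|] :=
  boolP [exists k : 'I_(n * n).+1, f ^+ (k : nat) == 0]; first by exists k.
rewrite negb_exists => /forallP fX0.
pose rs := [seq c * k%:R | k <- iota 0 (n * n).+1].
suff : (size rs < size (char_poly L))%N.
  by rewrite size_map size_iota size_char_poly ltnn.
apply: max_poly_roots; first exact/monic_neq0/char_poly_monic.
  apply/allP => x /mapP[k]; rewrite mem_iota /= add0n => lek -> {x}.
  rewrite -eigenvalue_root_char; apply/eigenvalueP; exists (mxvec (f ^+ k)).
    rewrite mul_vec_lin /= /weight_defect scale0r subr0 hfX.
    by rewrite linearZ.
  by rewrite mxvec_eq0; apply: (fX0 (Ordinal lek)).
rewrite map_inj_uniq ?iota_uniq // => i j /(mulfI c0)/eqP.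
by rewrite eqr_nat => /eqP.
Qed.

Section Sl2.
Variables (F : numFieldType) (n : nat) (e h f : 'M[F]_n).
Hypotheses (ef : lie_bracket e f = h) (he : lie_bracket h e = 2%:R *: e).
Hypothesis (hf : lie_bracket h f = - (2%:R *: f)).
Implicit Types (x : 'cV[F]_n) (W : {vspace 'cV[F]_n}).

Lemma mul_ef x : e *m (f *m x) = f *m (e *m x) + h *m x.
Proof. by rewrite -ef /lie_bracket mulmxBl !mulmxA addrC subrK. Qed.

Lemma mul_he x : h *m (e *m x) = e *m (h *m x) + 2%:R *: (e *m x).
Proof.
by rewrite scalemxAl -he /lie_bracket mulmxBl !mulmxA addrC subrK.
Qed.

Lemma mul_hf x : h *m (f *m x) = f *m (h *m x) - 2%:R *: (f *m x).
Proof.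
by rewrite scalemxAl -mulNmx -hf /lie_bracket mulmxBl !mulmxA addrC subrK.
Qed.

Lemma mul_hfX k x :
  h *m (f ^+ k *m x) = f ^+ k *m (h *m x) - (2 * k)%:R *: (f ^+ k *m x).
Proof.
elim: k => [|k IHk]; first by rewrite !mulmxX0 muln0 scale0r subr0.
rewrite !mulmxXS mul_hf IHk mulmxBr -scalemxAr -addrA -opprD -scalerDl.
by rewrite -natrD mulnS addnC.
Qed.

(** The commutator [e, f^(k+1)] = (k + 1) f^k (h - k). *)
Lemma mul_efXS k x :
  e *m (f ^+ k.+1 *m x) =
  f ^+ k.+1 *m (e *m x) + k.+1%:R *: (f ^+ k *m (h *m x - k%:R *: x)).
Proof.
elim: k => [|k IHk].
  by rewrite !mulmxXS !mulmxX0 mul_ef scale0r subr0 scale1r.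
rewrite mulmxXS mul_ef IHk mulmxDr -scalemxAr -!mulmxXS -addrA; congr (_ + _).
rewrite mul_hfX !mulmxBr -!scalemxAr !scalerBr !scalerA.
rewrite [in RHS]mulrSr scalerDl scale1r.
rewrite addrACA; congr (_ + _).
rewrite [in RHS]mulmxXS -mulmxXS -opprD -scalerDl; congr (- (_ *: _)).
by rewrite natr1 -!natrM -natrD; congr (1 *+ _); lia.
Qed.

(** P_N(h) for P_N the falling factorial with roots 0, ..., N - 1. *)
Fixpoint ffact_h N x : 'cV[F]_n :=
  if N is N'.+1 then ffact_h N' (h *m x - N'%:R *: x) else x.

Definition sl2_stable W : Prop :=
  forall x, x \in W -> [/\ e *m x \in W, h *m x \in W & f *m x \in W].

Lemma sl2_stableX W x k : sl2_stable W -> x \in W ->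
  e ^+ k *m x \in W /\ f ^+ k *m x \in W.
Proof.
move=> stW xW; elim: k => [|k [eW fW]]; first by rewrite !mulmxX0.
by rewrite !mulmxXS; case: (stW _ eW); case: (stW _ fW).
Qed.

Lemma sl2_stable0 : sl2_stable 0%VS.
Proof. by move=> x; rewrite memv0 => /eqP ->; rewrite !mulmx0 mem0v. Qed.

(** In the quotient by W, where x is killed by e, this computes e^N f^N x. *)
Lemma mul_eXfX W N x : sl2_stable W -> e *m x \in W ->
  e ^+ N *m (f ^+ N *m x) - N`!%:R *: ffact_h N x \in W.
Proof.
move=> stW; elim: N x => [|N IHN] x exW.
  by rewrite !mulmxX0 scale1r subrr mem0v.
rewrite mulmxXSr mul_efXS [_ *m (_ + _ *: _)]mulmxDr.
rewrite -[_ *m (_ *: (_ *m _))]scalemxAr /= factS natrM -scalerA -addrA.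
rewrite -scalerBr; apply: memvD.
  by apply: (sl2_stableX _ stW _).1; apply: (sl2_stableX _ stW _).2.
apply/memvZ/IHN; rewrite mulmxBr -scalemxAr; apply/memvB/memvZ/exW.
have -> : e *m (h *m x) = h *m (e *m x) - 2%:R *: (e *m x).
  by rewrite mul_he addrK.
by apply: memvB; [case: (stW _ exW) | apply: memvZ].
Qed.

Lemma ffact_h_eigen N x (mu : F) : h *m x = mu *: x ->
  ffact_h N x = (\prod_(i < N) (mu - i%:R)) *: x.
Proof.
elim: N x => [|N IHN] x hx; first by rewrite big_ord0 scale1r.
rewrite /= hx -scalerBl IHN ?scalerA ?big_ord_recr //.
by rewrite -scalemxAr hx !scalerA mulrC.
Qed.

Definition is_highest_vector (lam : nat) x : Prop :=
  e *m x = 0 /\ h *m x = lam%:R *: x.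

(** P_N has simple roots, so the kernel of P_N(h) is a sum of eigenspaces; the
    components are obtained one root at a time. *)
Lemma ker_e_ffact_h N x : e *m x = 0 -> ffact_h N x = 0 ->
  exists y : nat -> 'cV[F]_n,
    (forall i, is_highest_vector i (y i)) /\ x = \sum_(i < N) y i.
Proof.
elim: N x => [|N IHN] x ex0 /=.
  move=> ->; exists (fun => 0); rewrite big_ord0.
  by split=> // i; split; rewrite !mulmx0 ?scaler0.
have ehx0 : e *m (h *m x - N%:R *: x) = 0.
  have /eqP := mul_he x; rewrite ex0 mulmx0 scaler0 addr0 eq_sym => /eqP ehx.
  by rewrite mulmxBr ehx -scalemxAr ex0 scaler0 subrr.
case/(IHN _ ehx0) => y [yP xE].
pose z i := (i%:R - N%:R : F)^-1 *: y i.
exists (fun i => if (i < N)%N then z i else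
                 if i == N then x - \sum_(j < N) z j else 0).
have zP i : is_highest_vector i (z i).
  by case: (yP i) => ey hy; split; rewrite -scalemxAr ?ey ?hy ?scaler0 // !scalerA mulrC.
have ez0 : e *m (\sum_(j < N) z j) = 0.
  by rewrite mulmx_sumr big1 // => i _; case: (zP i).
split=> [i|].
  case: ltnP => _; first exact: zP.
  case: eqP => [->|_]; last by split; rewrite !mulmx0 ?scaler0.
  split; first by rewrite mulmxBr ex0 ez0 subrr.
  have key : h *m (\sum_(j < N) z j) - N%:R *: (\sum_(j < N) z j)
      = h *m x - N%:R *: x.
    rewrite xE mulmx_sumr scaler_sumr -sumrB; apply: eq_bigr => j _.
    case: (zP j) => _ ->; rewrite -scalerBl scalerA divff ?scale1r //.
    by rewrite subr_eq0 eqr_nat ltn_eqF.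
  have hx : h *m x = h *m (\sum_(j < N) z j) - N%:R *: (\sum_(j < N) z j) + N%:R *: x.
    by rewrite key subrK.
  by rewrite mulmxBr hx scalerBr addrAC [_ - _ - _]addrAC subrr add0r addrC.
rewrite big_ord_recr /= ltnn eqxx (eq_bigr (fun i : 'I_N => z i)) ?subrKC //.
by move=> i _; rewrite ltn_ord.
Qed.

(** On the kernel of e, N! P_N(h) = e^N f^N, which vanishes for large N as f is
    nilpotent; hence h is diagonalizable there with eigenvalues in nat. *)
Lemma ker_e_eigenbasis : exists (m : nat) (lam : 'I_m -> nat) (v : 'I_m -> 'cV[F]_n),
  [/\ forall i, is_highest_vector (lam i) (v i), free_family v
    & forall x, e *m x = 0 -> exists c : 'I_m -> F, x = \sum_i c i *: v i].
Proof.
have [N fN0] : exists N, f ^+ N = 0.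
  by apply: (@ad_eigenvector_nilpotent _ _ h f (- 2%:R));
    rewrite ?scaleNr // oppr_eq0 pnatr_eq0.
have kerP x : e *m x = 0 -> exists y : nat -> 'cV[F]_n,
    (forall i, is_highest_vector i (y i)) /\ x = \sum_(i < N) y i.
  move=> ex0; apply: ker_e_ffact_h => //.
  have exW : e *m x \in 0%VS by rewrite ex0 mem0v.
  have := mul_eXfX N sl2_stable0 exW.
  rewrite fN0 mul0mx mulmx0 sub0r memv0 oppr_eq0 scaler_eq0 pnatr_eq0.
  by rewrite -leqn0 leqNgt fact_gt0 => /eqP.
pose K := lker (linfun (mulmx e : 'cV[F]_n -> 'cV[F]_n)).
have KP x : (x \in K) = (e *m x == 0) by rewrite memv_ker lfunE.
have [s [sP Ks]] : exists s : seq 'cV[F]_n,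
    {in s, forall x, exists lam, is_highest_vector lam x} /\
    {subset (vbasis K : seq _) <= <<s>>%VS}.
  have: {in (vbasis K : seq _), forall x, e *m x = 0}.
    by move=> x /vbasis_mem; rewrite KP => /eqP.
  elim: (vbasis K : seq _) => [|x b IHb] bP; first by exists [::].
  have [|s [sP bs]] := IHb; first by move=> y yb; apply: bP; rewrite inE yb orbT.
  have [y [yP xE]] := kerP x (bP x (mem_head _ _)).
  exists ([seq y i | i <- iota 0 N] ++ s); split=> [z|z].
    by rewrite mem_cat => /orP[/mapP[i _ ->]|/sP //]; exists i.
  rewrite inE span_cat => /orP[/eqP ->|/bs zs]; last first.
    by apply: (subvP (addvSr _ _)).
  apply: (subvP (addvSl _ _)); rewrite xE; apply: memv_suml => i _.
  by apply/memv_span/map_f; rewrite mem_iota ltn_ord.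
have [t [ts freet tE]] := free_subseq s.
have [|lam lamP] := @fin_all_exists 'I_(size t) (fun=> nat)
    (fun i l => is_highest_vector l (tnth (in_tuple t) i)).
  by move=> i; apply: sP; apply: ts; apply: mem_tnth.
exists (size t), lam, (tnth (in_tuple t)); split=> //.
  have /(@freeP _ _ _ (in_tuple t)) freet' := freet.
  move=> c c0; apply: freet'; rewrite -[RHS]c0; apply: eq_bigr => i _.
  by rewrite [tnth _ _](tnth_nth 0).
move=> x /eqP; rewrite -KP => xK.
have /coord_span xE : x \in <<in_tuple t>>%VS.
  rewrite /= tE; move: xK; rewrite -(span_basis (vbasisP K)).
  by apply: subvP; apply/span_subvP.
exists (fun i => coord (in_tuple t) i x); rewrite {1}xE.
by apply: eq_bigr => i _; rewrite [tnth _ _](tnth_nth 0).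
Qed.

End Sl2.

(** * Jordan strings *)

Section Strings.
Variables (F : fieldType) (n : nat) (e : 'M[F]_n).
Variables (m : nat) (len : 'I_m -> nat) (X : 'I_m -> nat -> 'cV[F]_n).

Definition string_comb (c : 'I_m -> nat -> F) : 'cV[F]_n :=
  \sum_i \sum_(s < len i) c i s *: X i s.

(** The vectors X i s, for s < len i, are arranged in chains along which e
    acts as a weighted backward shift. *)
Definition string_action : Prop :=
  exists g : 'I_m -> nat -> F,
    (forall i, e *m X i 0%N = 0) /\
    forall i s, (s.+1 < len i)%N ->
      g i s != 0 /\ e *m X i s.+1 = g i s *: X i s.

Definition string_free : Prop :=
  forall c, string_comb c = 0 -> forall i s, (s < len i)%N -> c i s = 0.

Definition string_span : Prop := forall x, exists c, x = string_comb c.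

(** The k-th power of e takes the vectors of index k of the strings to those of
    index 0, up to nonzero factors, and kills the previous ones; so the
    coefficients vanish one index after another, from the largest down to j. *)
Lemma string_coef0 j c : string_action -> (forall i, 0 < len i)%N ->
  free_family (X^~ 0%N) -> e ^+ j *m string_comb c = 0 ->
  forall i s, (j <= s < len i)%N -> c i s = 0.
Proof.
case=> g [eX0 eXS] len_gt0 freeX ejc.
have eX_low i s k : (s < k)%N -> (s < len i)%N -> e ^+ k *m X i s = 0.
  elim: k s => // k IHk [|s] sk slen; first by rewrite mulmxXSr eX0 mulmx0.
  by rewrite mulmxXSr (eXS _ _ slen).2 -scalemxAr IHk ?scaler0 // ltnW.
have eX_diag i k : (k < len i)%N ->
    exists2 G, G != 0 & e ^+ k *m X i k = G *: X i 0%N.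
  elim: k => [|k IHk] klen; first by exists 1; rewrite ?oner_eq0 // mulmxX0 scale1r.
  have [G G0 eG] := IHk (ltnW klen); have [g0 eg] := eXS _ _ klen.
  exists (g i k * G); first by rewrite mulf_neq0.
  by rewrite mulmxXSr eg -scalemxAr eG scalerA.
suffices main k : (forall i s, (k <= s < len i)%N -> c i s = 0) ->
    forall i s, (j <= s < len i)%N -> c i s = 0.
  apply: (main (\max_i len i)) => i s /andP[ls sl].
  by have := leq_ltn_trans ls sl; rewrite ltnNge leq_bigmax.
elim: k => [|k IHk] ck; first by move=> i s /andP[_ sl]; apply: ck.
have [kj|jk] := ltnP k j.
  by move=> i s /andP[js sl]; apply: ck; rewrite (leq_trans kj js).
apply: IHk => i s /andP[]; rewrite leq_eqVlt => /orP[/eqP <- kl|ks sl]; last first.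
  by apply: ck; rewrite ks.
have [|G GP] := @fin_all_exists 'I_m (fun=> F) (fun i G => (k < len i)%N ->
    G != 0 /\ e ^+ k *m X i k = G *: X i 0%N).
  move=> i'; case: (ltnP k (len i')) => [/eX_diag[G G0 eG]|_]; first by exists G.
  by exists 0.
have sum0 : \sum_i (if (k < len i)%N then c i k * G i else 0) *: X i 0%N = 0.
  have : e ^+ k *m string_comb c = 0.
    by rewrite -(subnK jk) exprD -mulmxA ejc mulmx0.
  move=> ekc; rewrite -[RHS]ekc mulmx_sumr; apply: eq_bigr => i' _.
  rewrite mulmx_sumr.
  case: ltnP => [kl'|lk]; last first.
    rewrite scale0r big1 // => -[s' sl] _ /=.
    by rewrite -scalemxAr eX_low ?scaler0 // (leq_trans sl).
  rewrite (bigD1 (Ordinal kl')) //= big1 ?addr0 => [|[s' sl'] /= ns].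
    by rewrite -scalemxAr (GP _ kl').2 scalerA.
  have {ns} : s' != k by [].
  rewrite -scalemxAr; case: ltngtP => // [sk|sk] _.
    by rewrite eX_low ?scaler0.
  by rewrite ck ?scale0r // sk.
have := freeX _ sum0 i; rewrite kl => /eqP; rewrite mulf_eq0 => /orP[/eqP//|].
by have [/negPf ->] := GP i kl.
Qed.

Lemma string_action_free : string_action -> (forall i, 0 < len i)%N ->
  free_family (X^~ 0%N) -> string_free.
Proof.
move=> actX len_gt0 freeX c c0 i s sl.
by apply: (@string_coef0 0) sl => //; rewrite c0 mulmx0.
Qed.

Local Notation T := {i : 'I_m & 'I_(len i)}.

Let XT (a : T) := X (tag a) (tagged a).

Lemma string_combT c : string_comb c = \sum_(a : T) c (tag a) (tagged a) *: XT a.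
Proof. by rewrite /string_comb sig_big_dep. Qed.

Lemma string_coefT (c : T -> F) :
  exists c' : 'I_m -> nat -> F, forall a : T, c' (tag a) (tagged a) = c a.
Proof.
exists (fun i s => if insub s is Some o then c (@Tagged _ i (fun i => 'I_(len i)) o) else 0).
by case=> i s /=; rewrite valK.
Qed.

Lemma string_free_family : string_free -> free_family XT.
Proof.
move=> freeX c c0 a; have [c' c'E] := string_coefT c.
rewrite -c'E; apply: freeX => //; rewrite string_combT -[RHS]c0.
by apply: eq_bigr => b _; rewrite c'E.
Qed.

Lemma string_spanning_family : string_span -> spanning_family XT.
Proof.
move=> spanX x; have [c ->] := spanX x.
by exists (fun a : T => c (tag a) (tagged a)); rewrite string_combT.
Qed.

(** The kernel of e^j is spanned by the first j vectors of each string. *)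
Lemma dim_ker_string j : string_action -> (forall i, 0 < len i)%N ->
  free_family (X^~ 0%N) -> string_span ->
  \dim (lker (linfun (mulmx (e ^+ j) : 'cV[F]_n -> 'cV[F]_n)))
  = (\sum_i minn j (len i))%N.
Proof.
move=> actX len_gt0 freeX spanX.
have freeT := string_free_family (string_action_free actX len_gt0 freeX).
rewrite (@dimv_coord_support _ _ _ _ _ [pred a : T | (tagged a < j)%N] freeT
  (string_spanning_family spanX)); last first.
  move=> c; rewrite memv_ker lfunE /=; have [c' c'E] := string_coefT c.
  rewrite (eq_bigr (fun a : T => c' (tag a) (tagged a) *: XT a)); last first.
    by move=> a _; rewrite c'E.
  rewrite -string_combT; split=> [/eqP ker a|c0]; last first.
    case: (actX) => g [eX0 eXS].
    rewrite string_combT mulmx_sumr big1 // => a _; rewrite -scalemxAr c'E.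
    have [aj|/c0 ->] := boolP (a \in [pred a : T | (tagged a < j)%N]); last by rewrite scale0r.
    case: a aj => i [s sl]; rewrite inE /= /XT /= => sj.
    suff -> : e ^+ j *m X i s = 0 by rewrite scaler0.
    elim: j s sj sl {c0} => // k IHk [|s] sk sl; first by rewrite mulmxXSr eX0 mulmx0.
    by rewrite mulmxXSr (eXS _ _ sl).2 -scalemxAr IHk ?scaler0 // ltnW.
  rewrite inE -leqNgt -c'E => ja.
  by apply: (@string_coef0 j) => //; rewrite ja ltn_ord.
rewrite -sum1_card big_mkcond /=.
rewrite -(@sig_big_dep _ _ _ _ (fun i => 'I_(len i)) xpredT (fun _ => xpredT)
  (fun i s => if (s < j)%N then 1%N else 0%N)) /=.
apply: eq_bigr => i _; rewrite -big_mkcond /= sum1_card.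
rewrite -sum1_card -(big_mkord (fun s => s < j)%N (fun=> 1%N)) sum1_count.
rewrite /index_iota subn0.
elim: (len i) => [|l IHl]; first by rewrite minn0.
rewrite -addn1 iotaD count_cat IHl /= addn0 add0n; lia.
Qed.

End Strings.

Section Sl2Strings.
Variables (F : numFieldType) (n : nat) (e h f : 'M[F]_n).
Hypotheses (ef : lie_bracket e f = h) (he : lie_bracket h e = 2%:R *: e).
Hypothesis (hf : lie_bracket h f = - (2%:R *: f)).
Variables (m : nat) (lam : 'I_m -> nat) (v : 'I_m -> 'cV[F]_n).
Hypotheses (v_hw : forall i, is_highest_vector e h (lam i) (v i)).
Hypothesis (free_v : free_family v).
Hypothesis (ker_e_v :
  forall x, e *m x = 0 -> exists c : 'I_m -> F, x = \sum_i c i *: v i).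

Let X i s := f ^+ s *m v i.
Let len i := (lam i).+1.
Let T := {i : 'I_m & 'I_(len i)}.
Let comb := string_comb len X.

Lemma mul_h_string i s : h *m X i s = ((lam i)%:R - (2 * s)%:R) *: X i s.
Proof. by rewrite mul_hfX // (v_hw i).2 -scalemxAr -scalerBl. Qed.

Let g i s : F := s.+1%:R * ((lam i)%:R - s%:R).

Lemma mul_e_string0 i : e *m X i 0 = 0.
Proof. by rewrite /X mulmxX0 (v_hw i).1. Qed.

Lemma mul_e_stringS i s : e *m X i s.+1 = g i s *: X i s.
Proof.
rewrite (mul_efXS ef hf) (v_hw i).1 (v_hw i).2 mulmx0 add0r -scalerBl.
by rewrite -scalemxAr scalerA.
Qed.

Lemma string_coef_neq0 i s : (s < lam i)%N -> g i s != 0.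
Proof. by move=> sl; rewrite mulf_neq0 ?pnatr_eq0 // subr_eq0 eqr_nat gtn_eqF. Qed.

Lemma sl2_string_action : string_action e len X.
Proof.
exists g; split=> [i|i s sl]; first exact: mul_e_string0.
by split; [apply: string_coef_neq0 | apply: mul_e_stringS].
Qed.

Lemma sl2_string_free : string_free len X.
Proof.
apply: string_action_free sl2_string_action _ _ => // c; rewrite /X => c0.
apply: free_v; rewrite -[RHS]c0; apply: eq_bigr => i _; by rewrite mulmxX0.
Qed.

(** f^(lam+1) v is killed by e and has weight - lam - 2, but the weights of
    h on the kernel of e are natural numbers. *)
Lemma string_top i : X i (len i) = 0.
Proof.
have [N fN0] : exists N, f ^+ N = 0.
  by apply: (@ad_eigenvector_nilpotent _ _ h f (- 2%:R));
    rewrite ?scaleNr // oppr_eq0 pnatr_eq0.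
have eX0 : e *m X i (len i) = 0 by rewrite mul_e_stringS /g subrr mulr0 scale0r.
have := mul_eXfX ef he hf N (sl2_stable0 e h f) (x := X i (len i)).
rewrite eX0 => /(_ (mem0v _)); rewrite fN0 mul0mx mulmx0 sub0r memv0 oppr_eq0.
rewrite scaler_eq0 pnatr_eq0 -leqn0 leqNgt fact_gt0 /=.
rewrite (ffact_h_eigen _ (mul_h_string _ _)) scaler_eq0 => /orP[|/eqP //].
rewrite prodf_seq_eq0 => /hasP[j _ /=].
rewrite -addrA -opprD -natrD subr_eq0 eqr_nat /len => /eqP ?; lia.
Qed.

Let W : {vspace 'cV[F]_n} := (\sum_(a : T) <[X (tag a) (tagged a)]>)%VS.

Let WP x : reflect (exists c, x = comb c) (x \in W).
Proof.
apply: (iffP memv_sumP) => [[u uX ->]|[c ->]].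
  have [|c cP] := @fin_all_exists T (fun=> F)
      (fun a k => u a = k *: X (tag a) (tagged a)).
    by move=> a; apply/vlineP/uX.
  have [c' c'E] := string_coefT c.
  exists c'; rewrite /comb string_combT; apply: eq_bigr => a _.
  by rewrite cP c'E.
exists (fun a : T => c (tag a) (tagged a) *: X (tag a) (tagged a)).
  by move=> a _; apply/memvZ/memv_line.
by rewrite /comb string_combT.
Qed.

Let W_stable : sl2_stable e h f W.
Proof.
have XW i s : (s <= len i)%N -> X i s \in W.
  rewrite leq_eqVlt => /orP[/eqP ->|sl]; first by rewrite string_top mem0v.
  pose a : T := Tagged (fun i => 'I_(len i)) (Ordinal sl).
  by rewrite memvE; apply: (sumv_sup a).
move=> x /WP[c ->].
split; rewrite mulmx_sumr; apply: memv_suml => i _; rewrite mulmx_sumr;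
  apply: memv_suml => -[s sl] _ /=; rewrite -scalemxAr; apply: memvZ.
- case: s sl => [|s] sl; first by rewrite mul_e_string0 mem0v.
  by rewrite mul_e_stringS memvZ // XW // ltnW // ltnW.
- by rewrite mul_h_string memvZ // XW // ltnW.
- by rewrite /X -mulmxXS; apply: XW.
Qed.

(** Since e h = (h - 2) e, this moves e across P_N(h). *)
Lemma mul_e_ffact_h N x (b mu : 'I_m -> F) (u : 'I_m -> 'cV[F]_n) :
  (forall i, h *m u i = mu i *: u i) -> e *m x = \sum_i b i *: u i ->
  e *m ffact_h h N x =
  \sum_i (b i * \prod_(j < N) (mu i - 2%:R - j%:R)) *: u i.
Proof.
move=> hu; elim: N x b => [|N IHN] x b exE.
  by rewrite exE; apply: eq_bigr => i _; rewrite big_ord0 mulr1.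
rewrite (IHN _ (fun i => b i * (mu i - 2%:R - N%:R))) /=.
  by apply: eq_bigr => i _; rewrite big_ord_recr /= -!mulrA [in RHS](mulrC _ (_ - N%:R)).
have -> : e *m (h *m x - N%:R *: x) = h *m (e *m x) - 2%:R *: (e *m x) - N%:R *: (e *m x).
  by rewrite (mul_he he) addrK mulmxBr -scalemxAr.
rewrite exE mulmx_sumr !scaler_sumr -!sumrB; apply: eq_bigr => i _.
by rewrite -scalemxAr hu !scalerA -!scalerBl; congr (_ *: _); ring.
Qed.

Lemma mul_e_comb c :
  e *m comb c = \sum_i \sum_(s < lam i) (c i s.+1 * g i s) *: X i s.
Proof.
rewrite mulmx_sumr; apply: eq_bigr => i _.
rewrite mulmx_sumr big_ord_recl /= -scalemxAr mul_e_string0 scaler0 add0r.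
by apply: eq_bigr => s _; rewrite -scalemxAr mul_e_stringS scalerA.
Qed.

(** If e x lies in the span W of the strings, correct x by an element of W so
    that e x becomes a combination of the lowest vectors, of weights - lam i.
    Since x is killed by e modulo W, some P_N(h) x lies in W; but e P_N(h) x
    has the same lowest vectors up to nonzero factors, while e W contains no
    combination of lowest vectors. *)
Lemma mem_strings_of_e x : e *m x \in W -> x \in W.
Proof.
case/WP=> c exE.
pose d i s := if s is s'.+1 then c i s' / g i s' else 0.
pose b i := c i (lam i).
have exdE : e *m (x - comb d) = \sum_i b i *: X i (lam i).
  rewrite mulmxBr exE mul_e_comb -sumrB; apply: eq_bigr => i _.
  rewrite big_ord_recr /= addrAC -sumrB big1 ?add0r // => s _.
  by rewrite divfK ?subrr // string_coef_neq0.
have [N fN0] : exists N, f ^+ N = 0.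
  by apply: (@ad_eigenvector_nilpotent _ _ h f (- 2%:R));
    rewrite ?scaleNr // oppr_eq0 pnatr_eq0.
have W_sum : \sum_i b i *: X i (lam i) \in W.
  rewrite -exdE mulmxBr; apply: memvB; first by apply/WP; exists c.
  have dW : comb d \in W by apply/WP; exists d.
  by case: (W_stable dW).
have : ffact_h h N (x - comb d) \in W.
  have := mul_eXfX ef he hf N W_stable (x := x - comb d).
  rewrite exdE => /(_ W_sum); rewrite fN0 mul0mx mulmx0 sub0r memvN.
  by rewrite rpredZeq pnatr_eq0 -leqn0 leqNgt fact_gt0.
case/WP=> d' d'E.
have hX i : h *m X i (lam i) = (- (lam i)%:R) *: X i (lam i).
  by rewrite mul_h_string mul2n -addnn natrD opprD addrA subrr sub0r.
pose gam i : F := \prod_(j < N) (- (lam i)%:R - 2%:R - j%:R).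
have gam0 i : gam i != 0.
  rewrite /gam prodf_seq_neq0; apply/allP => j _ /=.
  by rewrite -!opprD oppr_eq0 -!natrD pnatr_eq0 !addn_eq0 /= andbF.
have b0 i : b i = 0.
  pose c' i s := if (s < lam i)%N then d' i s.+1 * g i s else - (b i * gam i).
  have /sl2_string_free/(_ i (lam i)) : string_comb len X c' = 0.
    have := mul_e_ffact_h N hX exdE; rewrite d'E mul_e_comb => /eqP.
    rewrite -subr_eq0 -sumrB => /eqP E; rewrite -[RHS]E; apply: eq_bigr => j _.
    rewrite big_ord_recr /= /c' ltnn scaleNr; congr (_ - _).
    by apply: eq_bigr => s _; rewrite ltn_ord.
  by rewrite ltnSn /c' ltnn => /(_ isT)/eqP; rewrite oppr_eq0 mulf_eq0 (negPf (gam0 i)) orbF => /eqP.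
have [|c2 xE] := ker_e_v (x := x - comb d).
  by rewrite exdE big1 // => i _; rewrite b0 scale0r.
rewrite -[x](subrK (comb d)); apply: memvD; last by apply/WP; exists d.
rewrite xE; apply: memv_suml => i _; apply: memvZ; apply/WP.
exists (fun j s => ((j == i) && (s == 0))%:R).
rewrite /comb /string_comb (bigD1 i) //= [X in _ + X]big1 ?addr0; last first.
  by move=> j /negPf ji; rewrite big1 // => s _; rewrite ji scale0r.
rewrite big_ord_recl /= eqxx scale1r /X mulmxX0 big1 ?addr0 // => s _.
by rewrite andbF scale0r.
Qed.

Lemma sl2_string_span : string_span len X.
Proof.
have [N eN0] : exists N, e ^+ N = 0.
  by apply: (@ad_eigenvector_nilpotent _ _ h e 2%:R); rewrite // pnatr_eq0.
move=> x; apply/WP.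
have : e ^+ N *m x \in W by rewrite eN0 mul0mx mem0v.
elim: N x {eN0} => [|N IHN] x; first by rewrite mulmxX0.
by rewrite mulmxXSr => /IHN/mem_strings_of_e.
Qed.

End Sl2Strings.

(** The number of parts equal to x is a second difference of
    j |-> sum of min (j, part). *)
Lemma perm_eq_sum_minn (s t : seq nat) : 0%N \notin s -> 0%N \notin t ->
  (forall j, \sum_(x <- s) minn j x = \sum_(x <- t) minn j x)%N -> perm_eq s t.
Proof.
move=> s0 t0 st.
have cnt x (u : seq nat) : (2 * \sum_(y <- u) minn x.+1 y =
    (\sum_(y <- u) minn x y) + (\sum_(y <- u) minn x.+2 y) + count_mem x.+1 u)%N.
  elim: u => [|y u IHu]; first by rewrite !big_nil.
  rewrite !big_cons /= !mulnDr IHu.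
  move: (\sum_(i <- u) minn x i)%N (\sum_(i <- u) minn x.+2 i)%N (count_mem _ _).
  move=> A B C; rewrite (_ : 2 * minn x.+1 y = minn x y + minn x.+2 y + (y == x.+1))%N.
    by rewrite -!addnA; congr addn; rewrite !addnA; lia.
  by case: eqVneq => [->|]; lia.
apply/allP => -[|x] _; rewrite /= ; first by rewrite (count_memPn s0) (count_memPn t0).
by have := cnt x s; rewrite !st cnt => /addnI ->.
Qed.

Section JordanStrings.
Variables (F : fieldType) (n : nat) (e : 'M[F]_n) (p : seq nat).
Let len (i : 'I_(size p)) := tnth (in_tuple p) i.
Variable P : 'M[F]_(n, \sum_(i < size p) len i).
Hypotheses (freeP : row_free P) (fullP : row_full P).
Hypothesis eP : e *m P = P *m jordan_mx F p.

Let Y i s : 'cV[F]_n :=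
  if insub s is Some o then col (@tagnat.Rank _ len i o) P else 0.

Let YE i s (sl : (s < len i)%N) : Y i s = col (tagnat.Rank i (Ordinal sl)) P.
Proof. by rewrite /Y insubT. Qed.

(** The column of index (i, s + 1) of e P = P J says that e maps the corresponding
    column of P to the one of index (i, s). *)
Lemma jordan_mxE i' s' i s :
  jordan_mx F p (@tagnat.Rank _ len i' s') (@tagnat.Rank _ len i s)
  = ((i' == i) && (s == s'.+1 :> nat))%:R.
Proof.
have -> : jordan_mx F p (@tagnat.Rank _ len i' s') (@tagnat.Rank _ len i s)
   = submxblock (jordan_mx F p) i' i s' s by rewrite [RHS]mxE.
rewrite /jordan_mx /mxdiag mxblockK; case: eqVneq => [ii'|_]; last by rewrite mxE.
by case: _ / ii' in s *; rewrite conform_mx_id mxE.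
Qed.

Lemma jordan_string_action : string_action e len Y.
Proof.
have eY i s (sl : (s < len i)%N) : e *m Y i s =
    \sum_i' \sum_(s' < len i') ((i' == i) && (s == s'.+1 :> nat))%:R *: Y i' s'.
  have -> : e *m Y i s = \sum_a jordan_mx F p a (tagnat.Rank i (Ordinal sl)) *: col a P.
    rewrite YE colE mulmxA -colE eP; apply/matrixP => a b; rewrite !mxE summxE.
    by apply: eq_bigr => c _; rewrite !mxE mulrC.
  rewrite sig_big_dep /= (reindex _ (tagnat.rank_bij_on)) /=.
  apply: eq_bigr => -[i' s'] _; rewrite tagnat.rankE /= jordan_mxE.
  by rewrite (YE (ltn_ord s')); congr (_ *: col _ P); congr tagnat.Rank; apply: val_inj.
exists (fun _ _ => 1); split=> [i|i s sl].
  have [l0|l_gt0] := posnP (len i).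
    by rewrite /Y insubF ?mulmx0 // l0.
  rewrite eY // big1 // => i' _; rewrite big1 // => s' _.
  by rewrite andbF scale0r.
split; first exact: oner_neq0.
rewrite eY // (bigD1 i) //= [X in _ + X]big1 ?addr0; last first.
  by move=> j /negPf ji; rewrite big1 // => s' _; rewrite ji scale0r.
rewrite (bigD1 (Ordinal (ltnW sl))) //= !eqxx [X in _ + X]big1 ?addr0 // => s'.
by rewrite -val_eqE /= eqSS eq_sym => /negPf ->; rewrite scale0r.
Qed.

Lemma jordan_comb c : string_comb len Y c
  = P *m \col_a c (tagnat.sig1 a) (tagnat.sig2 a).
Proof.
rewrite /string_comb sig_big_dep /= (reindex _ (tagnat.sig_bij_on)) /=.
apply/matrixP => a b; rewrite !mxE summxE; apply: eq_bigr => k _.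
rewrite !mxE (YE (ltn_ord (tagged (tagnat.sig k)))) !mxE mulrC; congr (P a _ * _).
by rewrite -[RHS]tagnat.sigK tagnat.rankE; congr tagnat.Rank; apply: val_inj.
Qed.

Let col_sig (c : 'I_(size p) -> nat -> F) (u : 'cV[F]_(\sum_(i < size p) len i)) :
  (forall i s (sl : (s < len i)%N), c i s = u (tagnat.Rank i (Ordinal sl)) 0) ->
  \col_a c (tagnat.sig1 a) (tagnat.sig2 a) = u.
Proof.
move=> cE; apply/matrixP => a b; rewrite mxE ord1 (cE _ _ (ltn_ord _)).
congr (u _ _); rewrite -[RHS]tagnat.sigK tagnat.rankE.
by congr tagnat.Rank; apply: val_inj.
Qed.

Lemma jordan_string_span : string_span len Y.
Proof.
move=> x; pose u := pinvmx P *m x.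
pose c i s := if insub s is Some o then u (@tagnat.Rank _ len i o) 0 else 0.
exists c; rewrite jordan_comb (col_sig (c := c) (u := u)).
  by rewrite /u mulmxA mulmxVp // mul1mx.
by move=> i s sl; rewrite /c insubT.
Qed.

Lemma jordan_bottom_free : (forall i, 0 < len i)%N -> free_family (Y^~ 0%N).
Proof.
move=> len_gt0 c c0 i.
pose c' i s := if s is 0 then c i else 0.
have : string_comb len Y c' = 0.
  rewrite -[RHS]c0; apply: eq_bigr => j _.
  rewrite (bigD1 (Ordinal (len_gt0 j))) //= big1 ?addr0 // => -[[|s] sl].
    by rewrite -val_eqE.
  by rewrite scale0r.
rewrite jordan_comb => /(congr1 (mulmx (pinvmx P))).
rewrite mulmxA mulVpmx // mul1mx mulmx0 => /matrixP/(_ (tagnat.Rank i (Ordinal (len_gt0 i))) 0).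
by rewrite !mxE /tagnat.sig2 /tagnat.sig1 /tagnat.Rank tagnat.rankK.
Qed.

End JordanStrings.

(** By comparing the kernels of the powers of e, the lengths of the strings
    form the partition of e. *)
Lemma sl2_partition (F : numFieldType) n (e h f : 'M[F]_n) (p : seq nat) :
  lie_bracket e f = h -> lie_bracket h e = 2%:R *: e ->
  lie_bracket h f = - (2%:R *: f) -> nilpotent_partition e p ->
  exists (m : nat) (lam : 'I_m -> nat) (v : 'I_m -> 'cV[F]_n),
  [/\ forall i, is_highest_vector e h (lam i) (v i),
      string_free (fun i => (lam i).+1) (fun i s => f ^+ s *m v i),
      string_span (fun i => (lam i).+1) (fun i s => f ^+ s *m v i)
    & perm_eq [seq (lam i).+1 | i : 'I_m] p].
Proof.
move=> ef he hf [_ p0 [P [freeP fullP eP]]].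
have [m [lam [v [v_hw free_v ker_v]]]] := ker_e_eigenbasis ef he hf.
have span_v := sl2_string_span ef he hf v_hw free_v ker_v.
exists m, lam, v; split=> //; first exact: (sl2_string_free ef hf v_hw free_v).
have len_gt0 i : (0 < tnth (in_tuple p) i)%N.
  by rewrite lt0n; apply: contraNneq p0 => <-; apply: mem_tnth.
apply: perm_eq_sum_minn => // [|j]; first by apply/mapP => -[].
rewrite big_map big_enum [RHS]big_tnth.
have <- := dim_ker_string j (jordan_string_action eP) len_gt0
  (jordan_bottom_free fullP len_gt0) (jordan_string_span freeP).
apply/esym/dim_ker_string => //; first exact: (sl2_string_action ef hf v_hw).
move=> c c0; apply: free_v; rewrite -[RHS]c0.
by apply: eq_bigr => i _; rewrite mulmxX0.
Qed.

Definition weight_basis (F : numFieldType) n (h : 'M[F]_n) (I : finType)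
    (x : I -> 'cV[F]_n) (w : I -> int) : Prop :=
  [/\ forall a, h *m x a = (w a)%:~R *: x a, free_family x & spanning_family x].

Lemma card_weight_basis (F : numFieldType) n (h : 'M[F]_n) (I : finType)
    (x : I -> 'cV[F]_n) (w : I -> int) (i : int) :
  weight_basis h x w ->
  #|[pred a | w a == i]| =
  \dim (lker (linfun (mulmx (h - i%:~R%:M) : 'cV[F]_n -> 'cV[F]_n))).
Proof.
case=> hx freex spanx; apply/esym/(dimv_coord_support freex spanx) => c.
rewrite memv_ker lfunE /= mulmx_sumr.
have hE a : (h - i%:~R%:M) *m (c a *: x a) = (c a * (w a - i)%:~R) *: x a.
  rewrite mulmxBl -scalemxAr hx mul_scalar_mx !scalerA -scalerBl intrB.
  by congr (_ *: _); ring.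
rewrite (eq_bigr _ (fun a _ => hE a)); split=> [/eqP c0 a|c0].
  rewrite inE -subr_eq0 => wa; have /eqP := freex _ c0 a.
  by rewrite mulf_eq0 intr_eq0 (negPf wa) orbF => /eqP.
rewrite big1 // => a _; have [/eqP ->|/c0 ->] := boolP (a \in [pred a | w a == i]).
  by rewrite subrr mulr0 scale0r.
by rewrite mul0r scale0r.
Qed.

(** A string of length l has the weights l - 1, l - 3, ..., 1 - l. *)
Lemma card_string_weights (l i : nat) :
  (\sum_(s < l) (l.-1 == i + 2 * s))%N = (i < l)%N && (odd l != odd i).
Proof.
have [/andP[il par]|] := boolP ((i < l)%N && (odd l != odd i)).
  have sl : ((l.-1 - i)./2 < l)%N by lia.
  rewrite (bigD1 (Ordinal sl)) //= big1 ?addn0; first by lia.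
  by move=> s; rewrite -val_eqE /= => /eqP sl'; lia.
by move=> par; rewrite big1 // => -[s sl] _ /=; lia.
Qed.

(** The last clause provides highest vectors, together with the fact that f^i does
    not vanish on those of weight i. *)
Lemma sl2_weight_basis (F : numFieldType) n (e h f : 'M[F]_n) (p : seq nat) :
  lie_bracket e f = h -> lie_bracket h e = 2%:R *: e ->
  lie_bracket h f = - (2%:R *: f) -> nilpotent_partition e p ->
  exists (I : finType) (x : I -> 'cV[F]_n) (w : I -> int),
  [/\ weight_basis h x w,
      forall i : nat, #|[pred a | w a == i]| = weight_dim p i
    & forall i : nat, i.+1 \in p ->
        exists2 y : 'cV[F]_n, h *m y = i%:R *: y & f ^+ i *m y != 0].
Proof.
move=> ef he hf /(sl2_partition ef he hf)[m [lam [v [v_hw freev spanv lam_p]]]].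
pose T : finType := {i : 'I_m & 'I_(lam i).+1}.
exists T, (fun a : T => f ^+ (tagged a) *m v (tag a)),
  (fun a : T => (lam (tag a))%:Z - (2 * tagged a)%N%:Z).
split.
- split; [|exact: (string_free_family freev)|exact: (string_spanning_family spanv)].
  by move=> a; rewrite (mul_h_string hf v_hw) intrB !pmulrn.
- move=> i; rewrite /weight_dim -(permP lam_p) -sum1_card big_mkcond /=.
  rewrite -(@sig_big_dep _ _ _ _ (fun i => 'I_(lam i).+1) xpredT (fun _ => xpredT)
    (fun j s => if (lam j)%:Z - (2 * s)%N%:Z == i then 1%N else 0%N)) /=.
  rewrite count_map -sum1_count [RHS]big_mkcond [RHS]big_enum /=; apply: eq_bigr => j _.
  transitivity (\sum_(s < (lam j).+1) (((lam j).+1).-1 == i + 2 * s))%N.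
    by apply: eq_bigr => s _; case: eqP; case: eqP => /=; lia.
  by rewrite card_string_weights.
- move=> i; rewrite -(perm_mem lam_p) => /mapP[j _ [->]].
  exists (v j); first exact: (v_hw j).2.
  apply/eqP => fv0; pose c k s : F := ((k == j) && (s == lam j :> nat))%:R.
  have : c j (lam j) = 0.
    apply: freev (ltnSn _); rewrite /string_comb (bigD1 j) //= big_ord_recr /= fv0.
    rewrite scaler0 addr0 big1 ?add0r => [|s _]; last by rewrite /c ltn_eqF ?andbF ?scale0r.
    by rewrite big1 // => k /negPf kj; rewrite big1 // => s _; rewrite /c kj scale0r.
  by rewrite /c !eqxx => /eqP; rewrite oner_eq0.
Qed.

(** * Eigenbases adapted to an invariant form *)

Section Form.
Variables (F : fieldType) (n : nat) (S : 'M[F]_n).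
Implicit Types (x y : 'cV[F]_n).

Definition bform x y : F := (x^T *m S *m y) 0 0.

Lemma bformDr x y1 y2 : bform x (y1 + y2) = bform x y1 + bform x y2.
Proof. by rewrite /bform mulmxDr mxE. Qed.

Lemma bformDl x1 x2 y : bform (x1 + x2) y = bform x1 y + bform x2 y.
Proof. by rewrite /bform linearD /= !mulmxDl mxE. Qed.

Lemma bformZr a x y : bform x (a *: y) = a * bform x y.
Proof. by rewrite /bform -scalemxAr mxE. Qed.

Lemma bformZl a x y : bform (a *: x) y = a * bform x y.
Proof. by rewrite /bform linearZ /= -!scalemxAl mxE. Qed.

Lemma bformNr x y : bform x (- y) = - bform x y.
Proof. by rewrite -scaleN1r bformZr mulN1r. Qed.

Lemma bformNl x y : bform (- x) y = - bform x y.
Proof. by rewrite -scaleN1r bformZl mulN1r. Qed.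

Lemma bform_sumr (I : finType) (P : pred I) x (y : I -> 'cV[F]_n) :
  bform x (\sum_(a | P a) y a) = \sum_(a | P a) bform x (y a).
Proof. by rewrite /bform mulmx_sumr summxE. Qed.

Lemma bform0r x : bform x 0 = 0.
Proof. by rewrite /bform mulmx0 mxE. Qed.

Lemma bform_nondeg x : S \in unitmx -> (forall y, bform x y = 0) -> x = 0.
Proof.
move=> uS x0; apply: trmx_inj; apply: (can_inj (mulmxK uS)).
rewrite trmx0 mul0mx; apply/rowP => j; rewrite [RHS]mxE -(x0 (delta_mx j 0)).
by rewrite /bform -colE [RHS]mxE.
Qed.

Lemma bform_sym (c : F) x y : S^T = c *: S -> bform y x = c * bform x y.
Proof.
move=> symS; have -> : bform y x = (y^T *m S *m x)^T 0 0 by rewrite [RHS]mxE.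
by rewrite !trmx_mul trmxK symS -scalemxAl -scalemxAr mulmxA mxE.
Qed.

Lemma bform_skew (h : 'M[F]_n) x y : h^T *m S + S *m h = 0 ->
  bform (h *m x) y = - bform x (h *m y).
Proof.
move=> /eqP; rewrite addr_eq0 => /eqP hS.
by rewrite /bform trmx_mul -(mulmxA x^T h^T) hS mulmxN mulNmx mxE !mulmxA.
Qed.

End Form.

Section MonomialFamily.
Variables (F : fieldType) (n : nat) (S : 'M[F]_n) (I : finType).
Variables (sigma : I -> I) (s : I -> F) (v : I -> 'cV[F]_n).
Local Notation B := (bform S).

(** The common shape of hyperbolic bases and of orthonormal bases. *)
Definition monomial_family : Prop :=
  [/\ involutive sigma, forall a, s a != 0
    & forall a b, B (v a) (v b) = if b == sigma a then s a else 0].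

Hypothesis mono_v : monomial_family.

Lemma monomial_free : free_family v.
Proof.
have [sigK s0 vB] := mono_v; move=> c c0 a.
have := congr1 (B (v (sigma a))) c0; rewrite bform0r bform_sumr (bigD1 a) //=.
rewrite bformZr vB sigK eqxx big1 ?addr0 => [|b /negPf ba].
  by move/eqP; rewrite mulf_eq0 (negPf (s0 _)) orbF => /eqP.
by rewrite bformZr vB sigK ba mulr0.
Qed.

(** The projection along the span of v to its orthogonal complement; the dual basis
    of v is v permuted by sigma, up to the factors s. *)
Definition orth_proj (x : 'cV[F]_n) : 'cV[F]_n :=
  x - \sum_a ((s (sigma a))^-1 * B (v (sigma a)) x) *: v a.

Lemma bform_orth_proj b x : B (v b) (orth_proj x) = 0.
Proof.
have [sigK s0 vB] := mono_v.
rewrite bformDr bformNr bform_sumr (bigD1 (sigma b)) //= bformZr vB eqxx sigK.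
rewrite big1 ?addr0 => [|a /negPf ab]; last by rewrite bformZr vB ab mulr0.
by rewrite mulrAC mulVf // mul1r subrr.
Qed.

Lemma bform_orth u x : (forall b, B u (v b) = 0) -> B u (orth_proj x) = B u x.
Proof.
move=> uv; rewrite bformDr bformNr bform_sumr big1 ?subr0 // => a _.
by rewrite bformZr uv mulr0.
Qed.

Lemma monomial_span (J : finType) (x : J -> 'cV[F]_n) :
  spanning_family x -> (forall b, orth_proj (x b) = 0) -> spanning_family v.
Proof.
move=> spanx px0 u; have [c ->] := spanx u.
exists (fun a => \sum_b c b * ((s (sigma a))^-1 * B (v (sigma a)) (x b))).
have -> : \sum_b c b *: x b =
    \sum_b \sum_a (c b * ((s (sigma a))^-1 * B (v (sigma a)) (x b))) *: v a.
  apply: eq_bigr => b _; rewrite {1}[x b](subr0_eq (px0 b)) scaler_sumr.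
  by apply: eq_bigr => a _; rewrite scalerA.
by rewrite exchange_big /=; apply: eq_bigr => a _; rewrite scaler_suml.
Qed.

Lemma orth_proj_weight (h : 'M[F]_n) (w : I -> F) x mu :
  h^T *m S + S *m h = 0 -> (forall a, h *m v a = w a *: v a) ->
  h *m x = mu *: x -> h *m orth_proj x = mu *: orth_proj x.
Proof.
move=> hS hv hx; have [sigK s0 vB] := mono_v.
have wB u y c d : h *m u = c *: u -> h *m y = d *: y -> B u y != 0 -> c = - d.
  move=> hu hy uy0; apply: (mulIf uy0).
  by rewrite mulNr -bformZl -bformZr -hu -hy; apply: bform_skew.
rewrite mulmxBr hx scalerBr mulmx_sumr scaler_sumr; congr (_ - _).
apply: eq_bigr => a _; rewrite -scalemxAr hv !scalerA.
have [->|vx0] := eqVneq (B (v (sigma a)) x) 0; first by rewrite !(mulr0, mul0r).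
rewrite -[mu]opprK -(wB _ _ _ _ (hv (sigma a)) hx vx0).
rewrite (wB _ _ _ _ (hv (sigma a)) (hv a)) ?opprK 1?mulrC //.
by rewrite vB sigK eqxx.
Qed.

End MonomialFamily.

Section HypIndex.
Variables (F : fieldType) (eps : F) (J : finType) (d : nat).

(** Hyperbolic pairs indexed by J, followed by d vectors paired with
    themselves. *)
Definition hyp_index : finType := (J * bool + 'I_d)%type.

Definition hyp_sigma (a : hyp_index) : hyp_index :=
  match a with inl (j, b) => inl (j, ~~ b) | inr o => inr o end.

Definition hyp_sign (a : hyp_index) : F :=
  if a is inl (_, true) then eps else 1.

Definition hyp_weight (w : J -> int) (a : hyp_index) : int :=
  match a with inl (j, b) => if b then - w j else w j | inr _ => 0 end.

Lemma hyp_sigmaK : involutive hyp_sigma.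
Proof. by case=> [[j b]|o] //=; rewrite negbK. Qed.

Lemma hyp_weight_sigma w a : hyp_weight w (hyp_sigma a) = - hyp_weight w a.
Proof. by case: a => [[j []]|o] /=; rewrite ?opprK ?oppr0. Qed.

Lemma hyp_sign_neq0 a : eps != 0 -> hyp_sign a != 0.
Proof. by case: a => [[j []]|o] //= _; rewrite oner_eq0. Qed.

End HypIndex.

Arguments hyp_sigma {J d} a.
Arguments hyp_sign {F} eps {J d} a.
Arguments hyp_weight {J d} w a.
Arguments hyp_sigmaK {J d}.

Section HyperbolicBasis.
Variables (F : numClosedFieldType) (n : nat) (S h : 'M[F]_n) (eps : F).
Hypotheses (eps1 : eps = 1 \/ eps = -1) (symS : S^T = eps *: S).
Hypotheses (unitS : S \in unitmx) (skew_h : h^T *m S + S *m h = 0).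
Local Notation B := (bform S).

Definition hyperbolic_family (J : finType) (d : nat)
    (v : hyp_index J d -> 'cV[F]_n) (w : J -> int) : Prop :=
  (forall a, h *m v a = (hyp_weight w a)%:~R *: v a) /\
  forall a b, B (v a) (v b) = if b == hyp_sigma a then hyp_sign eps a else 0.

Lemma eps_neq0 : eps != 0.
Proof. by case: eps1 => ->; rewrite ?oppr_eq0 oner_eq0. Qed.

Lemma eps_sqr : eps * eps = 1.
Proof. by case: eps1 => ->; rewrite ?mulrNN mulr1. Qed.

Lemma hyperbolic_monomial J d (v : hyp_index J d -> 'cV[F]_n) w :
  hyperbolic_family v w -> monomial_family S hyp_sigma (hyp_sign eps) v.
Proof.
case=> _ vB; split=> // [|a]; first exact: hyp_sigmaK.
exact: hyp_sign_neq0 eps_neq0.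
Qed.

Lemma bform_weight x y (c d : int) : h *m x = c%:~R *: x -> h *m y = d%:~R *: y ->
  B x y != 0 -> c = - d.
Proof.
move=> hx hy xy0; apply: (@intr_inj F); apply: (mulIf xy0).
by rewrite mulrNz mulNr -bformZl -bformZr -hx -hy; apply: bform_skew.
Qed.

Variables (K : finType) (x : K -> 'cV[F]_n) (wx : K -> int).
Hypotheses (hx : forall b, h *m x b = (wx b)%:~R *: x b) (spanx : spanning_family x).

(** A weight vector u orthogonal to itself and to the pairs found so far has, by
    nondegeneracy, a partner of opposite weight in the orthogonal complement. *)
Lemma hyperbolic_extend J (v : hyp_index J 0 -> 'cV[F]_n) w u mu :
  hyperbolic_family v w -> u != 0 -> h *m u = mu%:~R *: u ->
  (forall a, B u (v a) = 0) -> B u u = 0 ->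
  exists (v' : hyp_index (option J) 0 -> 'cV[F]_n) (w' : option J -> int),
    hyperbolic_family v' w'.
Proof.
move=> hypv u0 hu uv uu; have monov := hyperbolic_monomial hypv.
have [hv vB] := hypv.
pose pr := orth_proj S hyp_sigma (hyp_sign eps) v.
have [b ub0] : exists b, B u (pr (x b)) != 0.
  apply/existsP; apply: contraNT u0; rewrite negb_exists => /forallP ux.
  apply/eqP/(bform_nondeg unitS) => y; have [c ->] := spanx y.
  rewrite bform_sumr big1 // => b _; rewrite bformZr.
  have /negPn/eqP := ux b; rewrite /pr bform_orth // => ->.
  by rewrite mulr0.
pose y := (B u (pr (x b)))^-1 *: pr (x b).
have uy : B u y = 1 by rewrite bformZr mulVf.
have hpr : h *m pr (x b) = (wx b)%:~R *: pr (x b).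
  exact: (orth_proj_weight monov skew_h hv (hx b)).
have wb : wx b = - mu by rewrite -[RHS]opprK (bform_weight hu hpr ub0) !opprK.
have hy : h *m y = (- mu)%:~R *: y.
  by rewrite -scalemxAr hpr wb !scalerA mulrC.
have vy a : B (v a) y = 0 by rewrite bformZr bform_orth_proj ?mulr0.
clearbody y.
(* y - kap u is isotropic: if eps = 1, kap removes < y, y >, and if eps = -1
   there is nothing to remove; kap = 0 unless the weight of u is 0 *)
pose kap := B y y / 2%:R.
pose z := y - kap *: u.
have uz : B u z = 1 by rewrite bformDr bformNr bformZr uu mulr0 subr0.
have hz : h *m z = (- mu)%:~R *: z.
  rewrite mulmxBr hy -scalemxAr hu scalerBr !scalerA; congr (_ - _ *: _).
  have [yy0|yy0] := eqVneq (B y y) 0; first by rewrite /kap yy0 !mul0r mulr0.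
  have /eqP := bform_weight hy hy yy0; rewrite opprK.
  rewrite eq_sym -subr_eq0 opprK -mulr2n mulrn_eq0 /= => /eqP ->.
  by rewrite oppr0 mulrC.
have zz : B z z = 0.
  rewrite bformDr !bformDl !bformNr !bformNl !bformZr !bformZl uu uy.
  rewrite (bform_sym u y symS) uy /kap.
  case: (eps1) => E; rewrite E; first by field.
  have : B y y = - B y y by rewrite {1}(bform_sym y y symS) E mulN1r.
  move/eqP; rewrite -subr_eq0 opprK -mulr2n mulrn_eq0 /=.
  by move/eqP ->; field.
have vu a : B (v a) u = 0 by rewrite (bform_sym _ _ symS) uv mulr0.
have vz a : B (v a) z = 0 by rewrite bformDr bformNr bformZr vy vu mulr0 subr0.
have zv a : B z (v a) = 0 by rewrite (bform_sym _ _ symS) vz mulr0.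
have zu : B z u = eps by rewrite (bform_sym _ _ symS) uz mulr1.
exists (fun a : hyp_index (option J) 0 => match a with
  | inl (None, b) => if b then z else u
  | inl (Some j, b) => v (inl (j, b))
  | inr o => v (inr o) end).
exists (fun j => if j is Some i then w i else mu); split.
  by case=> [[[j|] []]|[]] //=.
move=> [[[j|] b1]|[]] // [[[k|] b2]|[]] //=.
- by case: b2; rewrite ?vz ?vu.
- by case: b1; rewrite ?zv ?uv.
- by case: b1; case: b2 => /=; rewrite ?zz ?zu ?uz ?uu.
Qed.

(** Hyperbolic pairs are split off as long as the orthogonal complement contains an
    isotropic weight vector.  Vectors of nonzero weight are isotropic, and in
    weight 0 two orthogonal anisotropic vectors combine into an isotropic one, so
    that at the end a complement of dimension at most 1 remains. *)
Lemma hyperbolic_basis_exists : exists (J : finType) (d : nat)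
    (v : hyp_index J d -> 'cV[F]_n) (w : J -> int),
  [/\ hyperbolic_family v w, spanning_family v & (d <= 1)%N].
Proof.
suffices grow k (J : finType) (v : hyp_index J 0 -> 'cV[F]_n) w :
    hyperbolic_family v w -> (n < #|J| + k)%N ->
    exists (J : finType) (d : nat) (v : hyp_index J d -> 'cV[F]_n) (w : J -> int),
    [/\ hyperbolic_family v w, spanning_family v & (d <= 1)%N].
  by apply: (grow n.+1 void (fun=> 0) (fun=> 0)); [split=> -[[[]]|[]] | rewrite addnS ltnS leq_addl].
elim: k J v w => [|k IHk] J v w hypv nJ.
  have := card_free_family (monomial_free (hyperbolic_monomial hypv)).
  rewrite card_sum card_prod card_bool card_ord dimvf dim_matrix addn0; lia.
have ext u mu : u != 0 -> h *m u = mu%:~R *: u ->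
  (forall a, B u (v a) = 0) -> B u u = 0 ->
  exists (J : finType) (d : nat) (v : hyp_index J d -> 'cV[F]_n) (w : J -> int),
    [/\ hyperbolic_family v w, spanning_family v & (d <= 1)%N].
  move=> u0 hu uv uu; have [v' [w' hypv']] := hyperbolic_extend hypv u0 hu uv uu.
  by apply: IHk hypv' _; rewrite card_option addSnnS.
have monov := hyperbolic_monomial hypv; have [hv vB] := hypv.
pose pr := orth_proj S hyp_sigma (hyp_sign eps) v.
have [/forallP pr0|] := boolP [forall b, pr (x b) == 0].
  exists J, 0, v, w; split=> //; apply: (monomial_span (S := S)) spanx _ => b.
  exact/eqP/pr0.
rewrite negb_forall => /existsP[b u0].
have sym0 y z : B y z = 0 -> B z y = 0.
  by move=> yz; rewrite (bform_sym _ _ symS) yz mulr0.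
have hpr : h *m pr (x b) = (wx b)%:~R *: pr (x b).
  exact: (orth_proj_weight monov skew_h hv (hx b)).
have prv a : B (pr (x b)) (v a) = 0 by apply/sym0/bform_orth_proj.
have [uu|uu] := eqVneq (B (pr (x b)) (pr (x b))) 0; first exact: ext hpr prv uu.
have wb0 : wx b = 0.
  have /eqP := bform_weight hpr hpr uu.
  by rewrite -subr_eq0 opprK -mulr2n mulrn_eq0 /= => /eqP.
have normalize y : B y y != 0 -> B ((sqrtC (B y y))^-1 *: y) ((sqrtC (B y y))^-1 *: y) = 1.
  move=> yy; rewrite bformZr bformZl mulrA -expr2 exprVn sqrtCK mulVf //.
pose u := (sqrtC (B (pr (x b)) (pr (x b))))^-1 *: pr (x b).
have uu1 : B u u = 1 by apply: normalize.
have hu : h *m u = 0 by rewrite -scalemxAr hpr wb0 scale0r scaler0.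
have uv a : B u (v a) = 0 by rewrite bformZl prv mulr0.
clearbody u.
pose v1 (a : hyp_index J 1) := match a with inl c => v (inl c) | inr _ => u end.
have hypv1 : hyperbolic_family v1 w.
  split=> [[[j b1]|o]|[[j b1]|o] [[k' b2]|o']] /=.
  - exact: (hv (inl (j, b1))).
  - by rewrite hu scale0r.
  - by rewrite vB.
  - exact: sym0.
  - exact: uv.
  - by rewrite uu1 !ord1 eqxx.
have monov1 := hyperbolic_monomial hypv1; have [hv1 vB1] := hypv1.
pose pr1 := orth_proj S hyp_sigma (hyp_sign eps) v1.
have [/forallP pr0|] := boolP [forall b, pr1 (x b) == 0].
  exists J, 1%N, v1, w; split=> //; apply: (monomial_span (S := S)) spanx _ => c.
  exact/eqP/pr0.
rewrite negb_forall => /existsP[c y0].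
have hpr1 : h *m pr1 (x c) = (wx c)%:~R *: pr1 (x c).
  exact: (orth_proj_weight monov1 skew_h hv1 (hx c)).
have pr1v a : B (pr1 (x c)) (v1 a) = 0 by apply/sym0/bform_orth_proj.
have pr1v0 a : B (pr1 (x c)) (v a) = 0.
  by case: a => [a|[]] //; apply: (pr1v (inl a)).
have [yy|yy] := eqVneq (B (pr1 (x c)) (pr1 (x c))) 0; first exact: ext hpr1 pr1v0 yy.
have wc0 : wx c = 0.
  have /eqP := bform_weight hpr1 hpr1 yy.
  by rewrite -subr_eq0 opprK -mulr2n mulrn_eq0 /= => /eqP.
pose y := (sqrtC (B (pr1 (x c)) (pr1 (x c))))^-1 *: pr1 (x c).
have yy1 : B y y = 1 by apply: normalize.
have hy : h *m y = 0 by rewrite -scalemxAr hpr1 wc0 scale0r scaler0.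
have yv a : B y (v a) = 0 by rewrite bformZl pr1v0 mulr0.
have yu : B y u = 0 by rewrite bformZl (pr1v (inr ord0)) mulr0.
clearbody y.
(* y + i u is isotropic because y and u are orthogonal unit vectors *)
apply: (ext (y + 'i *: u) 0).
- apply: contra_eq_neq yy1 => /eqP; rewrite addr_eq0 => /eqP {1}->.
  by rewrite bformNl bformZl (sym0 _ _ yu) mulr0 oppr0 eq_sym oner_eq0.
- by rewrite mulmxDr -scalemxAr hy hu scaler0 addr0 scale0r.
- by move=> a; rewrite bformDl bformZl yv uv mulr0 addr0.
- rewrite bformDr !bformDl !bformZr !bformZl yy1 yu (sym0 _ _ yu) uu1.
  by rewrite !mulr0 mulr1 addr0 add0r -expr2 sqrCi subrr.
Qed.

End HyperbolicBasis.

(** * Generic weights *)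

Lemma digits5_eq0 k (c : nat -> int) : (forall i, `|c i| <= 4) ->
  \sum_(i < k) c i * 5 ^+ i = 0 -> forall i, (i < k)%N -> c i = 0.
Proof.
elim: k c => // k IHk c c4; rewrite big_ord_recl expr0 mulr1.
rewrite (eq_bigr (fun i : 'I_k => 5 * (c i.+1 * 5 ^+ i))); last first.
  by move=> i _; rewrite lift0 exprS mulrCA.
rewrite -mulr_sumr; move: (\sum_(i < k) _) (IHk (c \o S)) => /= t.
move=> IHt /= c0; have := c4 0%N; have [t0|/eqP t0] := eqVneq t 0; last by lia.
move=> _ [|i] ik; first by lia.
by apply: (IHt (fun i => c4 i.+1) t0 i).
Qed.

Section GenericWeight.
Variables (J : finType) (d : nat).
Local Notation I := (hyp_index J d).
Implicit Types (a b : I).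

Let chi a (i : nat) : int :=
  if a is inl (j, b) then
    if enum_rank j == i :> nat then (if b then -1 else 1) else 0
  else 0.

(** A weight which, being written in base 5 with digits 1 and - 1, determines
    any unordered pair of noncancelling indices by the sum of their weights. *)
Definition generic_weight a : int := \sum_(i < #|J|) chi a i * 5 ^+ i.

Lemma generic_weight_sigma a : generic_weight (hyp_sigma a) = - generic_weight a.
Proof.
rewrite /generic_weight -sumrN; apply: eq_bigr => i _; rewrite -mulNr.
by case: a => [[j []]|o] //=; case: eqP => _; rewrite ?oppr0 ?opprK.
Qed.

Let chi_eq a b c e : generic_weight a + generic_weight b =
  generic_weight c + generic_weight e ->
  forall i, (i < #|J|)%N -> chi a i + chi b i = chi c i + chi e i.
Proof.
move=> abce i iJ; apply/eqP; rewrite -subr_eq0; apply/eqP.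
apply: (@digits5_eq0 #|J| (fun i => chi a i + chi b i - (chi c i + chi e i))) iJ.
  have chi1 x k : `|chi x k| <= 1 by case: x => [[j []]|o] //=; case: eqP.
  by move=> k; move: (chi1 a k) (chi1 b k) (chi1 c k) (chi1 e k); lia.
rewrite -[RHS](subrr (generic_weight c + generic_weight e)) -{1}abce.
by rewrite /generic_weight -!big_split -sumrB /=; apply: eq_bigr => k _; ring.
Qed.

Hypothesis d1 : (d <= 1)%N.

Let inr_eq (o o' : 'I_d) : (inr o : I) = inr o'.
Proof. by congr inr; apply: val_inj; case: o o' => i ? [] /=; lia. Qed.

Let chi_self j (b : bool) : chi (inl (j, b)) (enum_rank j) = if b then -1 else 1.
Proof. by rewrite /= eqxx. Qed.

Lemma generic_weight_inj : injective generic_weight.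
Proof.
move=> a b ab; have E := chi_eq (congr1 (+%R^~ (generic_weight a)) ab).
case: a b E {ab} => [[j b1]|o] [[k b2]|o'] E; last exact: inr_eq.
- have := E _ (ltn_ord (enum_rank j)); rewrite chi_self /=.
  case: eqP => [/val_inj/enum_rank_inj ->|_]; last by case: b1 {E}; lia.
  by case: b1 b2 {E} => -[] //; rewrite eqxx; lia.
- by have := E _ (ltn_ord (enum_rank j)); rewrite chi_self /=; case: b1 {E}; lia.
- have := E _ (ltn_ord (enum_rank k)); rewrite chi_self /=; case: b2 {E}; lia.
Qed.

(** The digits of a sum or difference of at most four weights have absolute value at
    most 4, so that [digits5_eq0] applies and the digits can be compared. *)
Lemma generic_weight_pair a b c e : a != hyp_sigma b ->
  generic_weight a + generic_weight b = generic_weight c + generic_weight e ->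
  (a = c /\ b = e) \/ (a = e /\ b = c).
Proof.
move=> ab abce; have E := chi_eq abce.
have inlP (x y : I) j (b1 : bool) : x = inl (j, b1) :> I -> x != hyp_sigma y ->
    0 < (if b1 then -1 else 1) * (chi x (enum_rank j) + chi y (enum_rank j)).
  move=> -> /=; rewrite eqxx; case: y => [[k b2]|o] /= xy; last by case: b1 {xy}.
  case: eqP => [/val_inj/enum_rank_inj kj|_]; last by case: b1 {xy}.
  by rewrite kj in xy; case: b1 b2 xy => -[] //=; rewrite eqxx.
have mem (x : I) j (b1 : bool) : 0 < (if b1 then -1 else 1) * chi x (enum_rank j) -> x = inl (j, b1).
  case: x => [[k b2]|o] /=; last by case: b1.
  case: eqP => [/val_inj/enum_rank_inj ->|_]; last by case: b1.
  by case: b1 b2 => -[].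
have one (x y : I) : x != hyp_sigma y -> (forall i, (i < #|J|)%N -> chi x i + chi y i = chi c i + chi e i) ->
    (exists j (b1 : bool), x = inl (j, b1)) -> x = c \/ x = e.
  move=> xy Exy [j [b1 xE]]; have := inlP _ _ _ _ xE xy.
  rewrite (Exy _ (ltn_ord _)) mulrDr => pos.
  have [/mem cE|le0] := ltP 0 ((if b1 then -1 else 1) * chi c (enum_rank j)).
    by left; rewrite xE cE.
  right; rewrite xE; apply/esym/mem; apply: lt_le_trans pos _.
  by rewrite -[leRHS]add0r lerD2r.
have sw : b != hyp_sigma a.
  by apply: contraNneq ab => ->; rewrite hyp_sigmaK.
have Eba i : (i < #|J|)%N -> chi b i + chi a i = chi c i + chi e i.
  by move=> iJ; rewrite addrC E.
have fin : a = c \/ a = e -> (a = c /\ b = e) \/ (a = e /\ b = c).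
  case=> ac; [left | right]; split=> //; apply: generic_weight_inj.
    by apply: (addrI (generic_weight a)); rewrite abce ac.
  by apply: (addrI (generic_weight a)); rewrite abce ac addrC.
have cases (x : I) : (exists j (b1 : bool), x = inl (j, b1)) \/ (exists o, x = inr o).
  by case: x => [[j b1]|o]; [left; exists j, b1 | right; exists o].
have [aL|[o aE]] := cases a; first exact/fin/(one a b ab E).
have [bL|[o' bE]] := cases b; last first.
  by case/eqP: ab; rewrite aE bE; apply: inr_eq.
have [bc|be] := one b a sw Eba bL.
  right; split=> //; apply: generic_weight_inj.
  by apply: (addIr (generic_weight b)); rewrite abce bc addrC.
left; split=> //; apply: generic_weight_inj.
by apply: (addIr (generic_weight b)); rewrite abce be.
Qed.

End GenericWeight.

(** * The graph of root vectors *)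

Section Layered.
Variables (I : finType) (sg : I -> I) (wt : I -> int) (N : nat).

Definition layer (i : nat) : {set I} := [set a | wt a == i%:Z].

(** The edge (a, b) stands for the root vector of g_1 mapping the basis vector
    of index a to that of index b; the same root vector maps the dual vector of
    index sg b to that of index sg a, which is why only the weights wt a >= 0
    are considered. *)
Definition layered_edges : {set I * I} :=
  [set ab | (0 <= wt ab.1) && (wt ab.2 == wt ab.1 + 1)].

(** The root vectors with edges in A commute.  Edges starting at dual vertices a
    and sg a give the root wt b + wt b', which in the orthogonal case is not a
    root if b = b'. *)
Definition independent_edges (orth : Prop) (A : {set I * I}) : Prop :=
  (forall a b c, (a, b) \in A -> (b, c) \in A -> False) /\
  (forall a b b', (a, b) \in A -> (sg a, b') \in A -> b = b' /\ orth).

Hypotheses (sgK : involutive sg) (wt_sg : forall a, wt (sg a) = - wt a).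
Local Notation d := (fun i => #|layer i|).
Hypotheses (d_mono : forall i, (#|layer i.+2| <= #|layer i|)%N).
Hypotheses (d_N : forall i, (N <= i)%N -> #|layer i| = 0%N).
Variable orth : Prop.

Lemma card_layers (A : {set I * I}) : A \subset layered_edges ->
  #|A| = (\sum_(0 <= i < N) #|[set ab in A | wt ab.1 == i%:Z]|)%N.
Proof.
move=> /subsetP AE; rewrite big_mkord -sum1_card.
have one ab : ab \in A -> (\sum_(i < N) (wt ab.1 == i%:Z) = 1)%N.
  move=> abA; have := AE _ abA; rewrite inE => /andP[w0 _].
  have iN : (absz (wt ab.1) < N)%N.
    rewrite ltnNge; apply/negP => /d_N/eqP; rewrite cards_eq0 => /eqP/setP/(_ ab.1).
    by rewrite !inE gez0_abs // eqxx.
  rewrite (bigD1 (Ordinal iN)) //= gez0_abs // eqxx big1 // => j.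
  by rewrite -val_eqE /= => jn; apply/eqP; rewrite eqb0; apply/eqP; lia.
rewrite (eq_bigr (fun ab => \sum_(i < N) (wt ab.1 == i%:Z) : nat)%N); last first.
  by move=> ab /one ->.
rewrite exchange_big /=; apply: eq_bigr => i _.
rewrite -sum1_card big_mkcond [RHS]big_mkcond /=; apply: eq_bigr => ab _.
by rewrite inE; case: (ab \in A) => //=; case: eqP.
Qed.

Definition block (Out In : {set I}) : {set I * I} :=
  [set ab in layered_edges | (ab.1 \in Out) && (ab.2 \in In)].

Lemma block_sub Out In : block Out In \subset layered_edges.
Proof. by apply/subsetP => ab; rewrite inE => /andP[]. Qed.

Lemma card_block Out In :
  #|block Out In| = (\sum_(0 <= i < N) #|layer i :&: Out| * #|layer i.+1 :&: In|)%N.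
Proof.
rewrite (card_layers (block_sub _ _)); apply: eq_bigr => i _.
rewrite -cardsX; congr #|pred_of_set _|; apply/setP => -[a b]; rewrite !inE /=.
case: (eqVneq (wt a) i%:Z) => [->|_]; rewrite ?andbF //= ?andbT.
have -> : (i.+1%:Z : int) = i%:Z + 1 by lia.
by case: (a \in Out); case: (b \in In); rewrite /= ?andbF ?andbT.
Qed.

Lemma card_layered_edges : #|layered_edges| = total_edges d N 0.
Proof.
have -> : layered_edges = block setT setT.
  by apply/setP => ab; rewrite !inE !andbT.
rewrite card_block; apply: eq_bigr => i _.
by rewrite !setIT.
Qed.

Lemma block_independent (Out In : {set I}) : [disjoint Out & In] ->
  (forall a, a \in Out -> wt a = 0 -> sg a \in Out -> False) \/
  orth /\ {in In &, forall b b', wt b = 1 -> wt b' = 1 -> b = b'} ->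
  independent_edges orth (block Out In).
Proof.
move=> dis pairs; split=> [a b c|a b b']; rewrite !inE /=.
  move=> /and3P[_ _ bI] /and3P[_ bO _].
  by move/pred0P/(_ b): dis; rewrite /= bO bI.
move=> /and3P[/andP[a0 /eqP ab] aO bI] /and3P[/andP[a0' /eqP ab'] aO' bI'].
have wa : wt a = 0 by move: a0'; rewrite wt_sg; lia.
case: pairs => [/(_ a aO wa aO') //|[o1 uniq]]; split=> //.
by apply: uniq => //; rewrite ?ab ?ab' ?wt_sg wa.
Qed.

Section UpperBound.
Variable A : {set I * I}.
Hypotheses (sAE : A \subset layered_edges) (indA : independent_edges orth A).

Let inset : {set I} := [set b | [exists a, (a, b) \in A]].
Let n i := #|layer i :&: inset|.
Let out a := #|[set b | (a, b) \in A]|.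
Let a0 := (\sum_(a in layer 0) out a)%N.

Lemma card_layer_targets i : (n i <= #|layer i|)%N.
Proof. by apply/subset_leq_card/subsetIl. Qed.

(** Above layer 0, edges run from vertices without incoming edges to vertices with
    incoming edges. *)
Lemma card_independent_le : (#|A| <= a0 + oriented_edges d N n 1)%N.
Proof.
rewrite (card_layers sAE); have [->|N0] := posnP N; first by rewrite big_geq.
rewrite big_ltn // leq_add //.
  rewrite /a0 (eq_bigr (fun a => \sum_(b | (a, b) \in A) 1)%N) => [|a _]; last first.
    by rewrite /out -sum1_card; apply: eq_bigl => b; rewrite inE.
  rewrite pair_big_dep /= -sum1_card; apply/eq_leq/eq_bigl => -[a b].
  by rewrite !inE andbC.
rewrite big_nat [leqRHS]big_nat; apply: leq_sum => i /andP[i0 _].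
have -> : (#|layer i| - n i = #|layer i :\: inset|)%N by rewrite cardsD.
rewrite -cardsX; apply/subset_leq_card/subsetP => -[a b]; rewrite !inE /=.
move=> /andP[abA /eqP wa]; have := subsetP sAE _ abA; rewrite inE /= => /andP[_ /eqP wb].
rewrite wa eqxx andbT; apply/and3P; split.
- by apply/negP => /existsP[c ca]; apply: indA.1 ca abA.
- by rewrite wb wa; apply/eqP; lia.
- by apply/existsP; exists a.
Qed.

Let out_le a : a \in layer 0 -> (out a <= n 1)%N.
Proof.
rewrite inE => /eqP wa; apply/subset_leq_card/subsetP => b; rewrite !inE => abA.
have := subsetP sAE _ abA; rewrite inE /= => /andP[_ /eqP ->].
by rewrite wa eqxx; apply/existsP; exists a.
Qed.

Let sg_layer0 a : (sg a \in layer 0) = (a \in layer 0).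
Proof. by rewrite !inE wt_sg oppr_eq0. Qed.

Let double_a0 : (2 * a0 = \sum_(a in layer 0) (out a + out (sg a)))%N.
Proof.
rewrite big_split /= mul2n -addnn; congr addn.
rewrite /a0 (reindex_inj (can_inj sgK)) /=; apply: eq_bigl => a; exact: sg_layer0.
Qed.

(** Both ends of a dual pair can only be used by two edges to the same vertex. *)
Let out_pair a : (0 < out a)%N -> (0 < out (sg a))%N ->
  orth /\ exists b, forall b', (a, b') \in A -> b' = b.
Proof.
move=> /card_gt0P[b]; rewrite inE => ab /card_gt0P[b']; rewrite inE => ab'.
split; first by have [] := indA.2 _ _ _ ab ab'.
by exists b' => b2 ab2; have [] := indA.2 _ _ _ ab2 ab'.
Qed.

Lemma independent_symplectic : ~ orth ->
  (#|layered_edges| <= 2 * #|A|)%N -> paired d 0 \/ paired d 1.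
Proof.
move=> north; rewrite card_layered_edges => le.
apply: (@extremal_symplectic d N d_mono d_N n card_layer_targets a0); last first.
  by apply: leq_trans le _; rewrite leq_mul2l card_independent_le.
rewrite double_a0 -sum_nat_const; apply: leq_sum => a aL.
have [->|oa] := posnP (out a); first by rewrite add0n out_le // sg_layer0.
have [->|osa] := posnP (out (sg a)); first by rewrite addn0 out_le.
by case: north; case: (out_pair oa osa).
Qed.

Lemma independent_orthogonal : #|layer 1| != 1%N ->
  (#|layered_edges| <= 2 * #|A|)%N ->
  let fix0 := #|[set a in layer 0 | sg a == a]| in
  [\/ paired d 0, paired d 1 /\ (fix0 = 0%N \/ #|layer 1| = 2%N)
    | #|layer 1| = 2%N /\ paired d 2].
Proof.
move=> d11; rewrite card_layered_edges => le fix0.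
have out1 a : (0 < out a)%N -> (0 < out (sg a))%N -> (out a <= 1)%N.
  move=> oa osa; have [_ [b bP]] := out_pair oa osa.
  by rewrite -(cards1 b); apply/subset_leq_card/subsetP => b'; rewrite !inE => /bP ->.
apply: (@extremal_orthogonal d N d_mono d_N n card_layer_targets a0) => //.
- by apply/subset_leq_card/subsetP => a; rewrite inE => /andP[].
- by move=> n0; apply: big1 => a aL; have := out_le aL; rewrite n0; lia.
- move=> n1; rewrite -sum1_card; apply: leq_sum => a aL.
  by rewrite -n1 out_le.
- move=> n2; rewrite double_a0.
  have -> : ((#|layer 0| - fix0) * n 1 + 2 * fix0 =
      \sum_(a in layer 0) (if sg a == a then 2 else n 1))%N.
    rewrite (bigID (fun a => sg a == a)) /= addnC; congr addn.
      rewrite (eq_bigr (fun=> 2%N)) => [|a /andP[_ ->] //].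
      rewrite sum_nat_cond_const mulnC; congr (_ * _)%N.
    rewrite (eq_bigr (fun=> n 1)) => [|a /andP[_ /negPf ->] //].
    rewrite sum_nat_cond_const; congr (_ * _)%N.
    have -> : fix0 = #|layer 0 :&: [set a | sg a == a]|.
      by apply: eq_card => a; rewrite !inE.
    by rewrite -cardsD; apply: eq_card => a; rewrite !inE andbC.
  apply: leq_sum => a aL; case: eqP => [fa|_].
    have [->|oa] := posnP (out a); first by rewrite fa; have := out1 a; rewrite fa; lia.
    by have := out1 a oa; rewrite fa; lia.
  have [->|oa] := posnP (out a); first by rewrite add0n out_le // sg_layer0.
  have [->|osa] := posnP (out (sg a)); first by rewrite addn0 out_le.
  have := out1 a oa osa; have := out1 (sg a) osa; rewrite sgK => /(_ oa); lia.
- by apply: leq_trans le _; rewrite leq_mul2l card_independent_le.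
Qed.

End UpperBound.
End Layered.

Section Constructions.
Variables (I : finType) (sg : I -> I) (wt : I -> int) (N : nat).
Hypotheses (sgK : involutive sg) (wt_sg : forall a, wt (sg a) = - wt a).
Local Notation layer := (layer wt).
Local Notation d := (fun i => #|layer i|).
Hypotheses (d_N : forall i, (N <= i)%N -> #|layer i| = 0%N).
Variable orth : Prop.

Definition half_independent : Prop := exists A : {set I * I},
  [/\ A \subset layered_edges wt, independent_edges sg orth A
    & (2 * #|A|)%N = #|layered_edges wt|].

Let oddw a := odd (absz (wt a)).

(** The edges from Out to In make up half of all edges below layer i by the
    hypothesis on sums, and half of those from layer i on by [paired_sum]. *)
Lemma half_block (Out In : {set I}) (i : nat) :
  let f j := (#|layer j :&: Out| * #|layer j.+1 :&: In|)%N in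
  [disjoint Out & In] ->
  (forall a, a \in Out -> wt a = 0 -> sg a \in Out -> False) \/
  orth /\ {in In &, forall b b', wt b = 1 -> wt b' = 1 -> b = b'} ->
  (2 * \sum_(0 <= j < i) f j = \sum_(0 <= j < i) #|layer j| * #|layer j.+1|)%N ->
  paired d i ->
  (forall k, f (i + 2 * k)%N = 0%N) ->
  (forall k, f (i + 2 * k).+1 = #|layer (i + 2 * k).+1| * #|layer (i + 2 * k).+2|)%N ->
  half_independent.
Proof.
move=> f dis indep init pi f0 f1; exists (block wt Out In); split.
- exact: block_sub.
- exact: block_independent.
have fN j : (N <= j)%N -> f j = 0%N.
  by move=> Nj; apply/eqP; rewrite muln_eq0 -leqn0 -{1}(d_N Nj) subset_leq_card ?subsetIl.
rewrite (card_layered_edges d_N) (card_block d_N).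
have sumN (g : nat -> nat) : (forall j, (N <= j)%N -> g j = 0%N) ->
    (\sum_(0 <= j < N) g j = \sum_(0 <= j < i) g j + \sum_(i <= j < N) g j)%N.
  move=> gN; have [iN|Ni] := leqP i N; first by rewrite (@big_cat_nat _ _ _ i 0 N).
  have Ni' := ltnW Ni; rewrite [X in (_ + X)%N]big_geq ?addn0 //.
  rewrite (@big_cat_nat _ _ _ N 0 i) //=.
  by rewrite [X in (_ + X)%N]big1_seq ?addn0 // => j /andP[_]; rewrite mem_index_iota => /andP[/gN].
rewrite (sumN _ fN) /total_edges (sumN (fun j => #|layer j| * #|layer j.+1|)%N); last first.
  by move=> j Nj; rewrite d_N.
rewrite mulnDr init; congr addn.
exact: (paired_sum d_N pi fN f0 f1).
Qed.

Let cap0 (i : nat) (X : {set I}) : (forall a, wt a = i%:Z -> a \notin X) ->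
  #|layer i :&: X| = 0%N.
Proof.
move=> iX; apply/eqP; rewrite cards_eq0; apply/eqP/setP => a; rewrite !inE.
by case: eqP => [/iX/negPf ->|].
Qed.

Let capT (i : nat) (X : {set I}) : (forall a, wt a = i%:Z -> a \in X) ->
  layer i :&: X = layer i.
Proof. by move=> iX; apply/setP => a; rewrite !inE; case: eqP => [/iX ->|]. Qed.

(** All edges from odd layers to the next even ones. *)
Lemma half_independent_even_odd : paired d 0 -> half_independent.
Proof.
move=> p0; apply: (@half_block [set a | oddw a] [set a | ~~ oddw a] 0) => //.
- by apply/pred0P => a /=; rewrite !inE andbN.
- by left=> a; rewrite inE /oddw => oa wa; move: oa; rewrite wa.
- by rewrite !big_geq.
- by move=> k; rewrite cap0 // => a wa; rewrite inE /oddw; lia.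
- by move=> k /=; rewrite !capT // => a wa; rewrite inE /oddw; lia.
Qed.

(** All edges from even layers to the next odd ones, except that only the half H of
    layer 0 is used, which contains one vertex of each dual pair. *)
Lemma half_independent_odd_even (H : {set I}) :
  (forall a, (sg a \in H) = (a \notin H)) -> paired d 1 -> half_independent.
Proof.
move=> sgH p1.
apply: (@half_block [set a | ~~ oddw a && ((wt a != 0) || (a \in H))] [set a | oddw a] 1) => //.
- by apply/pred0P => a /=; rewrite !inE; case: (oddw a); rewrite ?andbF.
- left=> a; rewrite !inE => aO wa; move: aO; rewrite wt_sg wa /= sgH.
  by move=> /andP[_ ->]; rewrite andbF.
- rewrite !big_nat1.
  have -> : layer 1 :&: [set a | oddw a] = layer 1.
    by apply: capT => a wa; rewrite inE /oddw wa.
  rewrite mulnA; congr (_ * _)%N.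
  have -> : layer 0 :&: [set a | ~~ oddw a && ((wt a != 0) || (a \in H))] = layer 0 :&: H.
    by apply/setP => a; rewrite !inE; case: eqP => // wa; rewrite /oddw wa ?eqxx.
  rewrite -(cardsID H (layer 0)) mul2n -addnn; congr addn.
  rewrite -(card_imset _ (can_inj sgK)); apply: eq_card => a.
  rewrite -{1}[a]sgK mem_imset; last exact: (can_inj sgK).
  by rewrite !inE wt_sg oppr_eq0 sgH andbC.
- by move=> k; rewrite cap0 // => a wa; rewrite inE /oddw; lia.
- by move=> k /=; rewrite !capT // => a wa; rewrite inE /oddw; lia.
Qed.

Let layer1_eq2 : #|layer 1| = 2%N -> exists b1 b2, [/\ layer 1 = [set b1; b2] & b1 != b2].
Proof. by move/eqP/cards2P => [b1 [b2 [ne ->]]]; exists b1, b2. Qed.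

(** As in [half_independent_odd_even], but all edges from layer 0 go to one of the
    two vertices of layer 1. *)
Lemma half_independent_odd_top_even : orth -> #|layer 1| = 2%N ->
  paired d 1 -> half_independent.
Proof.
move=> o1 /[dup] d12 /layer1_eq2[b1 [b2 [L1 b12]]] p1.
have wb1 : wt b1 = 1.
  by have : b1 \in layer 1 by [rewrite L1 !inE eqxx]; rewrite inE => /eqP.
apply: (@half_block [set a | ~~ oddw a] [set a | oddw a && ((wt a != 1) || (a == b1))] 1) => //.
- by apply/pred0P => a /=; rewrite !inE; case: (oddw a); rewrite ?andbF.
- right; split=> // b b'; rewrite !inE => bI b'I wb wb'; move: bI b'I.
  by rewrite wb wb' /= => /andP[_ /eqP ->] /andP[_ /eqP ->].
- rewrite !big_nat1 d12 capT => [|a wa]; last by rewrite inE /oddw wa.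
  suff -> : layer 1 :&: [set a | oddw a && ((wt a != 1) || (a == b1))] = [set b1].
    by rewrite cards1; lia.
  apply/setP => a; rewrite !inE; have [->|ne] := eqVneq a b1; first by rewrite /oddw wb1.
  by case: (eqVneq (wt a) 1); rewrite ?andbF.
- by move=> k; rewrite cap0 // => a wa; rewrite inE /oddw; lia.
- by move=> k /=; rewrite !capT // => a wa; rewrite inE /oddw; lia.
Qed.

(** All edges from layer 0 to one vertex of layer 1 and from the other one to layer
    2, and then all edges from the odd layers to the next even ones. *)
Lemma half_independent_ones : orth -> #|layer 1| = 2%N ->
  paired d 2 -> half_independent.
Proof.
move=> o1 /[dup] d12 /layer1_eq2[b1 [b2 [L1 b12]]] p2.
have wb1 : wt b1 = 1.
  by have : b1 \in layer 1 by [rewrite L1 !inE eqxx]; rewrite inE => /eqP.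
apply: (@half_block [set a | (wt a == 0) || oddw a && (a != b1)]
   [set a | (a == b1) || ~~ oddw a && (wt a != 0)] 2) => //.
- apply/pred0P => a /=; rewrite !inE; have [->|_] := eqVneq a b1; first by rewrite /oddw wb1.
  by case: eqP => [w0|_] /=; rewrite ?andbF ?andbT //; case: (oddw a).
- right; split=> // b b'; rewrite !inE => bI b'I wb wb'; move: bI b'I.
  by rewrite /oddw wb wb' /= !orbF => /eqP -> /eqP ->.
- rewrite !big_nat_recr //= !big_geq // !add0n d12.
  rewrite [X in #|pred_of_set X|]capT => [|a wa]; last by rewrite inE wa.
  have -> : layer 2 :&: [set a | (a == b1) || ~~ oddw a && (wt a != 0)] = layer 2.
    by apply: capT => a wa; rewrite inE /oddw wa orbT.
  have -> : layer 1 :&: [set a | (a == b1) || ~~ oddw a && (wt a != 0)] = [set b1].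
    apply/setP => a; rewrite !inE; have [->|ne] := eqVneq a b1; first by rewrite wb1.
    by case: eqP => // wa; rewrite /oddw wa.
  have -> : layer 1 :&: [set a | (wt a == 0) || oddw a && (a != b1)] = [set b2].
    apply/setP => a; rewrite !inE.
    have : (a \in layer 1) = (a \in [set b1; b2]) by rewrite L1.
    rewrite !inE => ->; have [->|ab1] := eqVneq a b1; first by rewrite (negPf b12) andbF wb1.
    have [->|_] //= := eqVneq a b2.
    have : b2 \in layer 1 by rewrite L1 !inE eqxx orbT.
    by rewrite inE => /eqP wb2; rewrite /oddw wb2.
  by rewrite !cards1; lia.
- move=> k; rewrite [X in (_ * X)%N]cap0 ?muln0 // => a wa.
  have ne : a != b1 by apply/eqP => E; move: wa; rewrite E wb1; lia.
  by rewrite inE (negPf ne) /oddw; lia.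
- move=> k /=; rewrite !capT // => a wa;
    have ne : a != b1 by [apply/eqP => E; move: wa; rewrite E wb1; lia].
    by rewrite inE (negPf ne) /oddw; lia.
  by rewrite inE ne /oddw; lia.
Qed.

End Constructions.

(** * The degree one part in an adapted basis *)

Lemma form_lie_bracket (F : fieldType) n (S X Y : 'M[F]_n) :
  X \in form_lie S -> Y \in form_lie S -> lie_bracket X Y \in form_lie S.
Proof.
rewrite !mem_form_lie !addr_eq0 => /eqP XS /eqP YS.
rewrite /lie_bracket linearB /= !trmx_mul mulmxBl -!mulmxA XS YS !mulmxN.
by rewrite !mulmxA XS YS !mulNmx mulmxBr !mulmxA !opprK opprB.
Qed.

Section Model.
Variables (F : numClosedFieldType) (n : nat) (S h : 'M[F]_n) (eps : F).
Hypotheses (eps1 : eps = 1 \/ eps = -1) (symS : S^T = eps *: S).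
Hypotheses (unitS : S \in unitmx) (skew_h : h^T *m S + S *m h = 0).
Local Notation B := (bform S).

Variables (J : finType) (d : nat) (w : J -> int).
Local Notation I := (hyp_index J d).
Variable v : I -> 'cV[F]_n.
Hypotheses (hypv : hyperbolic_family S h eps v w) (spanv : spanning_family v).
Hypothesis (d1 : (d <= 1)%N).
Local Notation wt := (hyp_weight w).
Local Notation sg := hyp_sigma.
Local Notation s := (hyp_sign eps).
Local Notation g1 := (weight_space (form_lie S) h 1).
Local Notation edges := (layered_edges (@hyp_weight J d w)).
Local Notation independent := (independent_edges (@hyp_sigma J d) (eps = 1)).

Implicit Types (a b : I).

Let hv a : h *m v a = (wt a)%:~R *: v a := hypv.1 a.
Let vB a b : B (v a) (v b) = if b == sg a then s a else 0 := hypv.2 a b.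
Let mono_v := hyperbolic_monomial eps1 hypv.
Let s0 (a : I) : s a != 0 := hyp_sign_neq0 _ (eps_neq0 eps1).

(** Matrix coefficients with respect to the form rather than to the basis: X lies in
    the Lie algebra if and only if they are skew (eps = 1) or symmetric
    (eps = -1). *)
Definition mcoef (X : 'M[F]_n) (a b : I) : F := B (v a) (X *m v b).

Lemma hyp_sign_sigma a : s (sg a) = eps * s a.
Proof.
have := vB (sg a) a; rewrite hyp_sigmaK eqxx => <-.
by rewrite (bform_sym _ _ symS) vB eqxx.
Qed.

Lemma bilinear_eq0 (M : 'M[F]_n) :
  (forall a b, bform M (v a) (v b) = 0) -> M = 0.
Proof.
move=> M0; have {}M0 x y : bform M x y = 0.
  have [c ->] := spanv x; have [c' ->] := spanv y.
  rewrite bform_sumr big1 // => b _; rewrite bformZr.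
  have -> : bform M (\sum_a c a *: v a) (v b) = \sum_a c a * bform M (v a) (v b).
    rewrite /bform linear_sum /= !mulmx_suml summxE; apply: eq_bigr => a _.
    exact: (bformZl M).
  by rewrite big1 ?mulr0 // => a _; rewrite M0 mulr0.
apply/matrixP => i j; rewrite [RHS]mxE -(M0 (delta_mx i 0) (delta_mx j 0)).
by rewrite /bform trmx_delta -rowE -colE !mxE.
Qed.

Lemma mcoef_eq0 X : (forall a b, mcoef X a b = 0) -> X = 0.
Proof.
move=> X0; apply: (can_inj (mulKmx unitS)); rewrite mulmx0.
by apply: bilinear_eq0 => a b; rewrite -[RHS](X0 a b) /bform mulmxA -mulmxA /mcoef /bform !mulmxA.
Qed.

Lemma mcoefB X Y a b : mcoef (X - Y) a b = mcoef X a b - mcoef Y a b.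
Proof. by rewrite /mcoef mulmxBl bformDr bformNr. Qed.

Lemma mcoefZ c X a b : mcoef (c *: X) a b = c * mcoef X a b.
Proof. by rewrite /mcoef -scalemxAl bformZr. Qed.

Lemma mcoef_sum (K : finType) (P : pred K) (X : K -> 'M[F]_n) a b :
  mcoef (\sum_(k | P k) X k) a b = \sum_(k | P k) mcoef (X k) a b.
Proof. by rewrite /mcoef mulmx_suml bform_sumr. Qed.

Lemma mcoef_mul X Y a b :
  mcoef (X *m Y) a b = \sum_(c : I) (s (sg c))^-1 * (mcoef X a c * mcoef Y (sg c) b).
Proof.
have expand x : x = \sum_(c : I) ((s (sg c))^-1 * B (v (sg c)) x) *: v c.
  apply/eqP; rewrite -subr_eq0; apply/eqP/(bform_nondeg unitS) => y.
  have [c ->] := spanv y; rewrite bform_sumr big1 // => b' _.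
  rewrite bformZr (bform_sym _ _ symS) [B (v b') _]/=.
  by have := bform_orth_proj mono_v b' x; rewrite /orth_proj => ->; rewrite !mulr0.
rewrite /mcoef -mulmxA {1}[Y *m v b]expand mulmx_sumr bform_sumr.
by apply: eq_bigr => c _; rewrite -scalemxAr bformZr -mulrA [X in _ * X]mulrC.
Qed.

Lemma form_lie_mcoef X :
  X \in form_lie S <-> forall a b, mcoef X b a = - eps * mcoef X a b.
Proof.
rewrite mem_form_lie; split=> [/eqP XS a b|XS].
  by rewrite /mcoef mulNr -(bform_sym _ _ symS) (bform_skew _ _ XS) opprK.
apply/eqP/bilinear_eq0 => a b.
have -> : bform (X^T *m S + S *m X) (v a) (v b) = B (X *m v a) (v b) + mcoef X a b.
  by rewrite /mcoef /bform mulmxDr mulmxDl mxE trmx_mul !mulmxA.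
by rewrite (bform_sym _ _ symS) -/(mcoef X b a) XS mulNr mulrN mulrA (eps_sqr eps1) mul1r addNr.
Qed.

Lemma g1P X : X \in g1 <->
  (forall a b, mcoef X b a = - eps * mcoef X a b) /\
  (forall a b, mcoef X a b != 0 -> wt a + wt b = -1).
Proof.
rewrite mem_weight_space; split=> [/andP[/form_lie_mcoef Xg /eqP hX]|[/form_lie_mcoef Xg Xw]].
  split=> // a b Xab; have := congr1 (fun Z => mcoef Z a b) hX.
  rewrite /lie_bracket scale1r mcoefB {1 2}/mcoef -!mulmxA hv -scalemxAr bformZr.
  rewrite -[B (v a) (h *m _)]opprK -(bform_skew _ _ skew_h) hv bformZl.
  rewrite -/(mcoef X a b) -mulNr -mulrBl -[in RHS](mul1r (mcoef X a b)) => /(mulIf Xab).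
  rewrite -opprD -intrD -[1]/(1%:~R) => /eqP; rewrite -mulrNz eqr_int.
  by rewrite eqr_oppLR => /eqP.
rewrite Xg /= scale1r; apply/eqP/eqP; rewrite -subr_eq0; apply/eqP/mcoef_eq0 => a b.
rewrite mcoefB /lie_bracket mcoefB {1 2}/mcoef -!mulmxA hv -scalemxAr bformZr.
rewrite -[B (v a) (h *m _)]opprK -(bform_skew _ _ skew_h) hv bformZl -/(mcoef X a b).
have [->|/Xw wab] := eqVneq (mcoef X a b) 0; first by rewrite !mulr0 !subr0 oppr0.
rewrite -mulNr -mulrBl -opprD -intrD wab mulrNz opprK mul1r; exact: subrr.
Qed.

(** The element of the Lie algebra with a single pair of nonzero coefficients, at
    (a, sg b) and (sg b, a). *)
Definition root_mx (ab : I * I) : 'M[F]_n :=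
  let E a b := (s a * s (sg b))^-1 *: (v (sg a) *m (v (sg b))^T *m S) in
  E ab.1 (sg ab.2) - eps *: E (sg ab.2) ab.1.

Lemma mcoef_root_mx ab a b : mcoef (root_mx ab) a b =
  ((a == ab.1) && (b == sg ab.2))%:R - eps * ((a == sg ab.2) && (b == ab.1))%:R.
Proof.
have mE (c e : I) : mcoef ((s c * s (sg e))^-1 *: (v (sg c) *m (v (sg e))^T *m S)) a b
    = ((a == c) && (b == e))%:R.
  rewrite mcoefZ /mcoef.
  have -> : B (v a) (v (sg c) *m (v (sg e))^T *m S *m v b)
      = B (v a) (v (sg c)) * B (v (sg e)) (v b).
    by rewrite /bform !mulmxA -!(mulmxA _ _ (v b)) -!(mulmxA _ (v (sg e))^T) mxE big_ord1 !mulmxA.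
  rewrite !vB hyp_sigmaK (can_eq hyp_sigmaK).
  rewrite (eq_sym c); case: eqP => [->|_] /=; last by rewrite mul0r mulr0.
  by case: eqP => _ /=; rewrite ?mulr0 // mulVf // mulf_neq0.
by rewrite /root_mx mcoefB mE (mcoefZ eps) mE.
Qed.

(** The two coefficients of a root vector do not both correspond to edges. *)
Lemma edges_flip a b c e : (a, b) \in edges -> (c, e) \in edges ->
  ~~ ((c == sg b) && (sg e == a)).
Proof.
rewrite !inE /= => /andP[a0 ab] /andP[c0 ce]; apply/negP => /andP[/eqP E _].
by move: ab c0; rewrite E hyp_weight_sigma; lia.
Qed.

Lemma mcoef_root_mx_edge ab ce : ab \in edges -> ce \in edges ->
  mcoef (root_mx ab) ce.1 (sg ce.2) = (ce == ab)%:R.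
Proof.
case: ab ce => [a b] [c e] ab ce; rewrite mcoef_root_mx /=.
rewrite (negPf (edges_flip ab ce)) mulr0 subr0 (can_eq hyp_sigmaK).
by rewrite xpair_eqE.
Qed.

Lemma root_mx_g1 ab : ab \in edges -> root_mx ab \in g1.
Proof.
case: ab => a b; rewrite inE /= => /andP[a0 /eqP ab]; apply/g1P; split=> c e.
  rewrite !mcoef_root_mx /= andbC [(e == sg b) && _]andbC.
  by rewrite mulrBr mulrA !mulNr (eps_sqr eps1) mul1r opprK addrC.
rewrite mcoef_root_mx /=; have [/andP[/eqP -> /eqP ->] _|_] := boolP (_ && _).
  by rewrite hyp_weight_sigma ab; lia.
have [/andP[/eqP -> /eqP ->] _|_] := boolP (_ && _).
  by rewrite hyp_weight_sigma ab; lia.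
by rewrite mulr0 subr0 eqxx.
Qed.

Lemma g1_eq0 X : X \in g1 ->
  {in edges, forall ab, mcoef X ab.1 (sg ab.2) = 0} -> X = 0.
Proof.
case/g1P=> Xs Xw X0; apply: mcoef_eq0 => a b; apply/eqP/negPn/negP => Xab.
have wab := Xw a b Xab.
have [a0|a0] := leP 0 (wt a).
  have := X0 (a, sg b); rewrite inE /= hyp_sigmaK hyp_weight_sigma.
  by move=> X0'; case/eqP: Xab; apply: X0'; lia.
have := X0 (b, sg a); rewrite inE /= hyp_sigmaK hyp_weight_sigma.
move=> X0'; case/eqP: Xab; rewrite Xs X0' ?mulr0 //; lia.
Qed.

Definition root_span (A : {set I * I}) : {vspace 'M[F]_n} :=
  (\sum_(ab in A) <[root_mx ab]>)%VS.

Lemma mem_root_span A X : X \in root_span A ->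
  exists c : I * I -> F, X = \sum_(ab in A) c ab *: root_mx ab.
Proof.
case/memv_sumP=> u uX ->.
have [|c cP] := @fin_all_exists (I * I)%type (fun=> F)
    (fun ab k => ab \in A -> u ab = k *: root_mx ab).
  move=> ab; case: (boolP (ab \in A)) => [/uX/vlineP[k ->]|_]; by [exists k | exists 0].
by exists c; apply: eq_bigr => ab abA; apply: cP.
Qed.

Lemma dim_root_span (A : {set I * I}) : A \subset edges ->
  \dim (root_span A) = #|A|.
Proof.
move=> /subsetP AE; apply: (@dimv_family _ _ _ root_mx).
- by move=> ab abA; rewrite memvE; apply: (sumv_sup ab).
- exact: mem_root_span.
move=> c c0 ab abA; have := congr1 (fun X => mcoef X ab.1 (sg ab.2)) c0.
rewrite mcoef_sum (bigD1 ab) //= mcoefZ mcoef_root_mx_edge ?AE // eqxx mulr1.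
rewrite big1 ?addr0 => [->|ce /andP[ceA ne]].
  by rewrite /mcoef mul0mx bform0r.
by rewrite mcoefZ mcoef_root_mx_edge ?AE // eq_sym (negPf ne) mulr0.
Qed.

Lemma root_span_sub (A : {set I * I}) : A \subset edges -> (root_span A <= g1)%VS.
Proof.
move=> /subsetP AE; apply/subv_sumP => ab abA.
by rewrite -memvE root_mx_g1 // AE.
Qed.

Lemma root_span_edges : root_span edges = g1.
Proof.
apply/eqP; rewrite eqEsubv root_span_sub //=; apply/subvP => X Xg.
pose Y := \sum_(ab in edges) mcoef X ab.1 (sg ab.2) *: root_mx ab.
have YE : Y \in root_span edges.
  apply: memv_suml => ab abE; apply: memvZ; rewrite memvE.
  exact: (sumv_sup ab).
suffices -> : X = Y by [].
apply: subr0_eq; apply: g1_eq0 => [|ab abE].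
  by apply: memvB => //; apply: (subvP (root_span_sub (subxx _))).
rewrite mcoefB mcoef_sum (bigD1 ab) //= mcoefZ mcoef_root_mx_edge // eqxx mulr1.
rewrite big1 ?addr0 ?subrr // => ce /andP[ceA ne].
by rewrite mcoefZ mcoef_root_mx_edge // eq_sym (negPf ne) mulr0.
Qed.

Lemma dim_g1 : \dim g1 = #|edges|.
Proof. by rewrite -root_span_edges dim_root_span. Qed.

Lemma mcoef_root_span A X a b : X \in root_span A -> mcoef X a b != 0 ->
  (a, sg b) \in A \/ (b, sg a) \in A.
Proof.
case/mem_root_span=> c ->; rewrite mcoef_sum => nz.
have [//|none] := pselect ((a, sg b) \in A \/ (b, sg a) \in A).
case/eqP: nz; rewrite big1 // => -[a' b'] abA; rewrite mcoefZ mcoef_root_mx /=.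
have [/andP[/eqP aa /eqP bb]|_] := boolP ((a == a') && _).
  by case: none; left; rewrite aa bb hyp_sigmaK.
have [/andP[/eqP aa /eqP bb]|_] := boolP (_ && _).
  by case: none; right; rewrite aa bb hyp_sigmaK.
by rewrite mulr0 subr0 mulr0.
Qed.

(** Each term of each coefficient of a commutator would need a conflict in A, except
    that in the orthogonal case terms on the diagonal may be nonzero; but diagonal
    coefficients vanish by skew symmetry. *)
Lemma root_span_abelian (A : {set I * I}) : A \subset edges ->
  independent A -> abelian_subspace (root_span A).
Proof.
move=> sAE [chainA pairA] X Y XA YA; apply: mcoef_eq0 => p r.
have wA a b : (a, b) \in A -> 0 <= wt a /\ wt b = wt a + 1.
  by move/(subsetP sAE); rewrite inE /= => /andP[-> /eqP ->].
have term0 X' Y' c : X' \in root_span A -> Y' \in root_span A ->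
    ~ (p = r /\ eps = 1) -> mcoef X' p c * mcoef Y' (sg c) r = 0.
  move=> X'A Y'A npr; apply/eqP; rewrite mulf_eq0 -[X in X || _]negbK -[X in _ || X]negbK -negb_and.
  apply/negP => /andP[].
  move=> /(mcoef_root_span X'A) pc /(mcoef_root_span Y'A) cr.
  case: pc cr => pc [] cr.
  - exact: chainA pc cr.
  - rewrite hyp_sigmaK in cr; move/wA: cr; move/wA: pc.
    by rewrite hyp_weight_sigma; lia.
  - have [pr e1] := pairA _ _ _ pc cr; apply: npr; split=> //.
    exact: (can_inj hyp_sigmaK).
  - by rewrite hyp_sigmaK in cr; exact: chainA cr pc.
have [[<- e1]|npr] := pselect (p = r /\ eps = 1); last first.
  by rewrite mcoefB !mcoef_mul !big1 ?subrr // => c _; rewrite term0 ?mulr0.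
have /form_lie_mcoef skew : lie_bracket X Y \in form_lie S.
  have sub Z : Z \in root_span A -> Z \in form_lie S.
    by move/(subvP (root_span_sub sAE)); rewrite mem_weight_space => /andP[].
  by apply: form_lie_bracket; apply: sub.
have /eqP := skew p p; rewrite e1 mulN1r -subr_eq0 opprK -mulr2n mulrn_eq0 /=.
by move/eqP.
Qed.

Lemma half_abelian_of_independent (A : {set I * I}) : A \subset edges ->
  independent A -> (2 * #|A|)%N = #|edges| -> half_abelian_in g1.
Proof.
move=> sAE indA cardA; exists (root_span A).
by rewrite root_span_sub // dim_root_span // dim_g1; split=> //; apply: root_span_abelian.
Qed.

Section Pivots.
Variable U : {vspace 'M[F]_n}.
Hypotheses (sUg : (U <= g1)%VS) (abelU : abelian_subspace U).
Local Notation th := (@generic_weight J d).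

(** Some element of U has its leading coefficient at (p, q), for the order given
    by the generic weights. *)
Definition pivot p q : Prop := exists2 X, X \in U &
  mcoef X p q != 0 /\
  forall p' q', th p + th q < th p' + th q' -> mcoef X p' q' = 0.

Let U_skew X a b : X \in U -> mcoef X b a = - eps * mcoef X a b.
Proof. by move/(subvP sUg)/g1P => [? _]. Qed.

Let U_weight X a b : X \in U -> mcoef X a b != 0 -> wt a + wt b = -1.
Proof. by move/(subvP sUg)/g1P => [_]; apply. Qed.

(** If the commutator of two pivot root vectors were nonzero, it would be the
    leading term of the commutator of two elements of U. *)
Lemma pivot_independent p q r : pivot p q -> pivot (sg q) r ->
  p = r /\ eps = 1.
Proof.
case=> X XU [Xpq Xlead] [Y YU [Yqr Ylead]].
have wpq := U_weight XU Xpq; have wqr := U_weight YU Yqr.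
have := congr1 (fun Z => mcoef Z p r) (abelU XU YU).
rewrite mcoefB !mcoef_mul [mcoef 0 _ _]/mcoef mul0mx bform0r.
(* in the coefficient of X Y at (p, r) only the product of leading terms occurs *)
have first c : mcoef X p c * mcoef Y (sg c) r != 0 -> c = q.
  rewrite mulf_eq0 negb_or => /andP[Xpc Ycr]; apply: (generic_weight_inj d1).
  have le1 : th p + th c <= th p + th q.
    by rewrite leNgt; apply: contra Xpc => lt; rewrite Xlead.
  have le2 : th (sg c) + th r <= th (sg q) + th r.
    by rewrite leNgt; apply: contra Ycr => lt; rewrite Ylead.
  by move: le1 le2; rewrite !generic_weight_sigma; lia.
have sum1 (f : I -> F) c0 (g : I -> F) : (forall c, f c != 0 -> c = c0) ->
    \sum_c g c * f c = g c0 * f c0.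
  move=> fc; rewrite (bigD1 c0) //= big1 ?addr0 // => c /negP cc0.
  by case: (eqVneq (f c) 0) => [->|/fc/eqP //]; rewrite mulr0.
rewrite (sum1 _ _ (fun c => (s (sg c))^-1) first).
(* in Y X a term of the same weight can only come from the same two edges *)
have second c : mcoef Y p c * mcoef X (sg c) r != 0 -> p = r /\ c = sg q.
  rewrite mulf_eq0 negb_or => /andP[Ypc Xcr].
  have le1 : th p + th c <= th (sg q) + th r.
    by rewrite leNgt; apply: contra Ypc => lt; rewrite Ylead.
  have le2 : th (sg c) + th r <= th p + th q.
    by rewrite leNgt; apply: contra Xcr => lt; rewrite Xlead.
  have E : th p + th c = th (sg q) + th r.
    by move: le1 le2; rewrite !generic_weight_sigma; lia.
  have pc : p != sg c.
    apply/eqP => pc; have := U_weight YU Ypc.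
    by rewrite pc hyp_weight_sigma; lia.
  case: (generic_weight_pair d1 pc E) => [[pq _]|[-> ->] //].
  by move: wpq; rewrite pq hyp_weight_sigma; lia.
have fst0 : (s (sg q))^-1 * (mcoef X p q * mcoef Y (sg q) r) != 0.
  by rewrite !mulf_neq0 // invr_neq0.
have [pr|npr] := eqVneq p r; last first.
  rewrite big1 ?subr0 => [/eqP|c _]; first by rewrite (negPf fst0).
  apply/eqP; rewrite mulf_eq0 -[X in _ || X]negbK.
  by apply/orP; right; apply/negP => /second[/eqP]; rewrite (negPf npr).
rewrite (sum1 _ (sg q) (fun c => (s (sg c))^-1)) => [comm|c /second[]//].
split=> //; case: (eps1) => // e1; case/eqP: fst0; move: comm.
rewrite -pr hyp_sigmaK (U_skew p q XU) (U_skew (sg q) p YU).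
rewrite hyp_sign_sigma e1 opprK !mul1r mulN1r invrN mulNr [mcoef Y _ _ * _]mulrC.
by rewrite -opprD => /eqP; rewrite oppr_eq0 -mulr2n mulrn_eq0 /= => /eqP ->; rewrite oppr0.
Qed.

Lemma pivot_sym p q : pivot p q -> pivot q p.
Proof.
case=> X XU [Xpq lead]; exists X => //; split=> [|p' q' lt].
  by rewrite (U_skew p q XU) mulf_neq0 // oppr_eq0 (eps_neq0 eps1).
by apply: lead; rewrite addrC.
Qed.

Definition pivot_edges : {set I * I} :=
  [set ab in edges | `[< pivot ab.1 (sg ab.2) >]].

Lemma pivot_edges_independent : independent pivot_edges.
Proof.
split=> [a b c|a b b']; rewrite !inE /= => /andP[abE /asboolP ab] /andP[bcE /asboolP bc].
  have [|ac _] := pivot_independent ab (r := sg c); first by rewrite hyp_sigmaK.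
  by move: abE bcE; rewrite ac hyp_weight_sigma; lia.
have [bb e1] := pivot_independent (pivot_sym ab) bc; split=> //.
exact: (can_inj hyp_sigmaK).
Qed.

(** The edge where the generic weight is largest among the nonzero coefficients. *)
Lemma mem_pivot_edges X : X \in U -> X != 0 ->
  exists2 ab, ab \in pivot_edges & mcoef X ab.1 (sg ab.2) != 0.
Proof.
move=> XU X0; pose P ab := (ab \in edges) && (mcoef X ab.1 (sg ab.2) != 0).
have [ab0 Pab0] : exists ab, P ab.
  apply/existsP; apply: contraNT X0; rewrite negb_exists => /forallP nP.
  apply/eqP/(g1_eq0 (subvP sUg _ XU)) => ab abE; apply/eqP.
  by have := nP ab; rewrite /P abE /= negbK.
case: (arg_maxP (fun ab => th ab.1 + th (sg ab.2)) Pab0) => ab /andP[abE Xab] max.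
exists ab => //; rewrite inE abE /=; apply/asboolP; exists X => //; split=> // p q.
apply: contraTeq => Xpq; rewrite -leNgt.
have wpq := U_weight XU Xpq; have [p0|p0] := leP 0 (wt p).
  have := max (p, sg q); rewrite /P inE /= hyp_sigmaK hyp_weight_sigma Xpq; apply.
  by rewrite p0 andbT /=; lia.
have := max (q, sg p); rewrite /P inE /= hyp_sigmaK hyp_weight_sigma (addrC (th q)); apply.
rewrite (U_skew p q XU) mulf_neq0 ?andbT ?oppr_eq0 ?(eps_neq0 eps1) //; lia.
Qed.

(** By [mem_pivot_edges] an element of U with vanishing coefficients at all pivots is
    0, so the coefficients at the pivots embed U. *)
Lemma dim_le_pivots : (\dim U <= #|pivot_edges|)%N.
Proof.
pose M := \matrix_(i < \dim U, k < #|pivot_edges|)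
  mcoef (vbasis U)`_i (enum_val k).1 (sg (enum_val k).2).
rewrite leqNgt; apply/negP => lt; have : ~~ row_free M.
  by rewrite /row_free neq_ltn (leq_ltn_trans (rank_leq_col M) lt).
rewrite -kermx_eq0 => /rowV0Pn[c /sub_kermxP cM c0].
pose X := \sum_i c 0 i *: (vbasis U)`_i.
have XU : X \in U.
  by apply: memv_suml => i _; apply/memvZ/vbasis_mem/mem_nth; rewrite size_tuple.
have X0 : X != 0.
  apply: contraNneq c0 => X0; apply/eqP/rowP => i; rewrite [RHS]mxE.
  by have /freeP/(_ (c 0) X0) := basis_free (vbasisP U).
have [ab abP] := mem_pivot_edges XU X0; case/eqP.
have := congr1 (fun N : 'rV_#|pivot_edges| => N 0 (enum_rank_in abP ab)) cM.
rewrite !mxE => cM0; rewrite -[RHS]cM0 mcoef_sum; apply: eq_bigr => i _.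
by rewrite mcoefZ mxE enum_rankK_in.
Qed.

End Pivots.

(** Half-dimensional abelian subspaces may be taken to be spanned by root
    vectors: replace U by the span of the leading terms of its elements. *)
Lemma half_abelian_independent : half_abelian_in g1 ->
  exists A : {set I * I},
    [/\ A \subset edges, independent A & (#|edges| <= 2 * #|A|)%N].
Proof.
case=> U [sUg abelU dimU]; exists (pivot_edges U); split.
- by apply/subsetP => ab; rewrite inE => /andP[].
- exact: pivot_edges_independent.
- by rewrite -dim_g1 -dimU leq_mul2l dim_le_pivots.
Qed.

End Model.

(** * The classical Lie algebras *)

Section FormLie.
Variables (F : numClosedFieldType) (n : nat) (S e h f : 'M[F]_n) (eps : F).
Variable p : seq nat.
Hypotheses (eps1 : eps = 1 \/ eps = -1) (symS : S^T = eps *: S).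
Hypotheses (unitS : S \in unitmx) (tri : sl2_triple (form_lie S) e h f).
Hypothesis (jordan : nilpotent_partition e p).
Local Notation g1 := (weight_space (form_lie S) h 1).
Local Notation W := (weight_dim p).

Let skew x : x \in form_lie S -> x^T *m S + S *m x = 0.
Proof. by rewrite mem_form_lie => /eqP. Qed.

(** Each hyperbolic pair takes two dimensions, which determines the number d of
    self-dual vectors. *)
Lemma adapted_basis : exists (J : finType) (d : nat)
    (v : hyp_index J d -> 'cV[F]_n) (w : J -> int),
  [/\ hyperbolic_family S h eps v w, spanning_family v, d = odd n
    & forall i, #|layer (@hyp_weight J d w) i| = W i].
Proof.
have [[eg hg fg] ef he hf] := tri.
have [K [x [wx [xP Wx _]]]] := sl2_weight_basis ef he hf jordan.
have [hx _ spanx] := xP.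
have [J [d [v [w [hypv spanv d1]]]]] :=
  hyperbolic_basis_exists eps1 symS unitS (skew hg) hx spanx.
have freev := monomial_free (hyperbolic_monomial eps1 hypv).
exists J, d, v, w; split=> // [|i].
  have := card_basis_family freev spanv.
  rewrite card_sum card_prod card_bool card_ord dimvf dim_matrix => nE.
  have {nE} : (#|J| * 2 + d)%N = n by rewrite nE; lia.
  by move=> <-; lia.
rewrite -Wx cardsE (card_weight_basis i xP).
by apply: card_weight_basis; split=> //; case: hypv.
Qed.

(** A highest vector y of odd weight i would be isotropic for the
    antisymmetric form < f^i y, y >, so it cannot span its weight space.  If the
    dimension were 1 in weight i, it would still be 1 in the largest weight k >= i
    of the same parity, which is that of a highest vector. *)
Lemma weight_dim_odd i : eps = 1 -> odd i -> W i != 1%N.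
Proof.
move=> e1 io; apply/eqP => Wi.
have [[eg hg fg] ef he hf] := tri.
have [K [x [wx [xP Wx top]]]] := sl2_weight_basis ef he hf jordan.
have [k [ki ko kp Wk]] : exists k, [/\ (i <= k)%N, odd k, k.+1 \in p & W k = 1%N].
  have : has (fun z => (i < z)%N && (odd z != odd i)) p by rewrite has_count -/(W i) Wi.
  case/hasP=> z zp /andP[iz zi]; exists z.-1; split; try lia.
    by rewrite prednK //; lia.
  apply/eqP; rewrite eqn_leq -{1}Wi; apply/andP; split.
    by apply: sub_count => t /=; lia.
  rewrite -has_count; apply/hasP; exists z => //; lia.
have [y hy fy] := top k kp.
have [hx freex spanx] := xP.
have /cards1P[a0 a0P] : #|[set a | wx a == k%:Z]| == 1%N.
  by rewrite cardsE Wx Wk.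
have a0w a : (wx a == k%:Z) = (a == a0) by rewrite -in_set1 -a0P inE.
have [c yE] : exists c, y = c *: x a0.
  have [c yE] := spanx y; exists (c a0).
  have c0 a : a != a0 -> c a = 0.
    move=> aa0; have := freex (fun b => c b * ((wx b)%:~R - k%:R)) _ a.
    have -> : \sum_b (c b * ((wx b)%:~R - k%:R)) *: x b = h *m y - k%:R *: y.
      rewrite yE mulmx_sumr scaler_sumr -sumrB; apply: eq_bigr => b _.
      by rewrite -scalemxAr hx !scalerA -scalerBl mulrBr [k%:R * _]mulrC.
    rewrite hy subrr => /(_ erefl)/eqP; rewrite mulf_eq0 => /orP[/eqP //|].
    by rewrite subr_eq0 pmulrn eqr_int a0w (negPf aa0).
  rewrite {1}yE (bigD1 a0) //= big1 ?addr0 // => a /c0 ->.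
  by rewrite scale0r.
have c_neq0 : c != 0 by apply: contraNneq fy => c0; rewrite yE c0 scale0r mulmx0.
have hfy : h *m (f ^+ k *m y) = (- k%:Z)%:~R *: (f ^+ k *m y).
  rewrite (mul_hfX hf) hy -scalemxAr -scalerBl; congr (_ *: _).
  by rewrite mul2n -addnn natrD opprD addrA subrr sub0r mulrNz.
have skewX j u z : bform S (f ^+ j *m u) z = (-1) ^+ j * bform S u (f ^+ j *m z).
  elim: j u z => [|j IHj] u z; first by rewrite !mulmxX0 mul1r.
  rewrite mulmxXS (bform_skew _ _ (skew fg)) IHj -mulmxXSr [(-1) ^+ j.+1]exprS mulN1r mulNr.
  by [].
case/eqP: fy; apply: (bform_nondeg unitS) => z.
have [b ->] := spanx z; rewrite bform_sumr big1 // => a _; rewrite bformZr.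
have [aa0|aa0] := eqVneq a a0; last first.
  have [->|nz] := eqVneq (bform S (f ^+ k *m y) (x a)) 0; first by rewrite mulr0.
  have /eqP := bform_weight (skew hg) hfy (hx a) nz.
  by rewrite eqr_opp eq_sym a0w (negPf aa0).
have : bform S (f ^+ k *m y) y = 0.
  have := skewX k y y; rewrite -signr_odd ko expr1 mulN1r.
  rewrite (bform_sym (f ^+ k *m y) y symS) e1 mul1r => /eqP.
  by rewrite -subr_eq0 opprK -mulr2n mulrn_eq0 /= => /eqP.
rewrite {2}yE bformZr -aa0 => /eqP; rewrite mulf_eq0 (negPf c_neq0) /= => /eqP ->.
by rewrite mulr0.
Qed.

Section Adapted.
Variables (J : finType) (d : nat) (v : hyp_index J d -> 'cV[F]_n) (w : J -> int).
Hypotheses (hypv : hyperbolic_family S h eps v w) (spanv : spanning_family v).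
Hypothesis (dn : d = odd n).
Hypothesis (layerW : forall i, #|layer (@hyp_weight J d w) i| = W i).
Local Notation I := (hyp_index J d).
Local Notation wt := (@hyp_weight J d w).
Local Notation sg := (@hyp_sigma J d).

Let d1 : (d <= 1)%N. Proof. by rewrite dn leq_b1. Qed.

Let wt_sg (a : I) : wt (sg a) = - wt a. Proof. exact: hyp_weight_sigma. Qed.

Let layer_mono i : (#|layer wt i.+2| <= #|layer wt i|)%N.
Proof. by rewrite !layerW weight_dim_mono. Qed.

Let layer_N i : (largest_part p <= i)%N -> #|layer wt i| = 0%N.
Proof. by move=> Li; rewrite layerW weight_dim_eq0. Qed.

Let paired_layer i : paired (fun j => #|layer wt j|) i <-> paired W i.
Proof. by split=> pi k; have := pi k; rewrite !layerW. Qed.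

Lemma half_abelian_of_graph : half_independent sg wt (eps = 1) -> half_abelian_in g1.
Proof.
have [[_ hg _] _ _ _] := tri; case=> A [AE indA cardA].
exact: (half_abelian_of_independent eps1 symS unitS (skew hg) hypv spanv d1 AE indA cardA).
Qed.

Lemma half_abelian_to_graph : half_abelian_in g1 -> exists A : {set I * I},
  [/\ A \subset layered_edges wt, independent_edges sg (eps = 1) A
    & (#|layered_edges wt| <= 2 * #|A|)%N].
Proof.
have [[_ hg _] _ _ _] := tri.
exact: (half_abelian_independent eps1 symS unitS (skew hg) hypv spanv d1).
Qed.

(** The second vectors of the hyperbolic pairs. *)
Lemma hyp_half (a : I) : d = 0%N ->
  let H : {set I} := [set a | if a is inl (_, b) then b else false] in
  (sg a \in H) = (a \notin H).
Proof.
by case: a => [[j b]|[o od]] d0 /=; rewrite !inE //; exfalso; move: od; rewrite d0.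
Qed.

Lemma card_self_dual : #|[set a in layer wt 0 | sg a == a]| = d.
Proof.
rewrite -[RHS]card_ord -cardsT -(card_imset _ (@inr_inj (J * bool)%type 'I_d)).
apply: eq_card => -[[j b]|o]; rewrite !inE /=.
  have -> : (inl (j, ~~ b) == inl (j, b) :> I) = false by case: b; apply/eqP; case.
  by rewrite andbF; apply/esym/negbTE/imsetP; case.
by rewrite !eqxx; apply/esym/imsetP; exists o.
Qed.

Let paired_half_even : paired W 0 -> half_abelian_in g1.
Proof.
move=> /paired_layer p0; apply: half_abelian_of_graph.
exact: (half_independent_even_odd wt_sg layer_N _ p0).
Qed.

Let paired_half_odd : d = 0%N -> paired W 1 -> half_abelian_in g1.
Proof.
move=> d0 /paired_layer p1; apply: half_abelian_of_graph.
exact: (half_independent_odd_even (@hyp_sigmaK J d) wt_sg layer_N _ (fun a => hyp_half a d0) p1).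
Qed.

Lemma half_abelian_symplectic_adapted : eps = -1 -> ~~ odd n ->
  half_abelian_in g1 <-> paired W 0 \/ paired W 1.
Proof.
move=> e1 n_even; have d0 : d = 0%N by rewrite dn (negPf n_even).
split=> [/half_abelian_to_graph[A [AE indA cardA]]|[/paired_half_even|/(paired_half_odd d0)] //].
have north : ~ eps = 1.
  rewrite e1 => /eqP; rewrite eq_sym -subr_eq0 opprK -[1]/(1%:R) -natrD pnatr_eq0; by [].
have := independent_symplectic (@hyp_sigmaK J d) wt_sg layer_mono layer_N AE indA north cardA.
by case=> /paired_layer; [left | right].
Qed.

Lemma half_abelian_orthogonal_adapted : eps = 1 -> half_abelian_in g1 <->
  [\/ paired W 0, paired W 1 /\ (~~ odd n \/ W 1 = 2%N) | W 1 = 2%N /\ paired W 2].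
Proof.
move=> e1; split=> [/half_abelian_to_graph[A [AE indA cardA]]|].
  have l1 : #|layer wt 1| != 1%N by rewrite layerW weight_dim_odd.
  have := independent_orthogonal (@hyp_sigmaK J d) wt_sg layer_mono layer_N AE indA l1 cardA.
  rewrite card_self_dual layerW.
  case=> [/paired_layer|[/paired_layer p1 dW]|[W1 /paired_layer]].
  - by constructor 1.
  - constructor 2; split=> //; case: dW => [/eqP|]; last by right.
    by rewrite dn eqb0; left.
  - by constructor 3.
case=> [/paired_half_even //|[p1 [n_even|W1]]|[W1 /paired_layer p2]].
- by apply: paired_half_odd p1; rewrite dn (negPf n_even).
- apply: half_abelian_of_graph; rewrite -layerW in W1; move/paired_layer: p1 => p1.
  exact: (half_independent_odd_top_even wt_sg layer_N e1 W1 p1).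
- apply: half_abelian_of_graph; rewrite -layerW in W1.
  exact: (half_independent_ones wt_sg layer_N e1 W1 p2).
Qed.

End Adapted.

Lemma half_abelian_symplectic : eps = -1 -> ~~ odd n ->
  half_abelian_in g1 <-> paired W 0 \/ paired W 1.
Proof.
have [J [d [v [w [hypv spanv dn layerW]]]]] := adapted_basis.
exact: half_abelian_symplectic_adapted hypv spanv dn layerW.
Qed.

Lemma half_abelian_orthogonal : eps = 1 -> half_abelian_in g1 <->
  [\/ paired W 0, paired W 1 /\ (~~ odd n \/ W 1 = 2%N) | W 1 = 2%N /\ paired W 2].
Proof.
have [J [d [v [w [hypv spanv dn layerW]]]]] := adapted_basis.
exact: half_abelian_orthogonal_adapted hypv spanv dn layerW.
Qed.

End FormLie.

Theorem corollary3p7 (R : realType) (X : classical_type) (r : nat)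
    (e h f : 'M[R[i]]_(std_dim X r)) (p : seq nat) :
  simple_lie (classical_lie R[i] X r) ->
  e \in classical_lie R[i] X r ->
  nilpotent_mx e ->
  sl2_triple (classical_lie R[i] X r) e h f ->
  nilpotent_partition e p ->
  (half_abelian_in (weight_space (classical_lie R[i] X r) h 1) <->
     partition_condition X p) /\
  (half_abelian_in (weight_space (classical_lie R[i] X r) h 1) <->
     listed_partition X p).
Proof.
move=> _ _ _ tri jordan; have p0 : 0%N \notin p by case: jordan.
suff listed : half_abelian_in (weight_space (classical_lie R[i] X r) h 1) <->
    listed_partition X p.
  split=> //; apply: iff_trans listed _; apply: iff_sym.
  exact: partition_conditionP.
have sym1 m : (1%:M : 'M[R[i]]_m)^T = 1 *: 1%:M by rewrite trmx1 scale1r.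
case: X e h f tri jordan => e h f tri jordan.
- have W_odd := fun i => weight_dim_odd (i := i) (sym1 _) (unitmx1 _ _) tri jordan erefl.
  apply: iff_trans (half_abelian_orthogonal (or_introl erefl) (sym1 _) (unitmx1 _ _) tri jordan erefl) _.
  apply: iff_trans (iff_sym (listed_odd_orthogonal p0 W_odd)).
  have -> : odd (std_dim TypeB r) by rewrite /= oddD addbb.
  split; case.
  + by constructor 1.
  + by case=> p1 [//|W1]; constructor 2.
  + by constructor 3.
  + by constructor 1.
  + by case=> W1 p1; constructor 2; split; [|right].
  + by constructor 3.
- apply: iff_trans (iff_sym (listed_symplectic p0)).
  have eps1 : (-1 : R[i]) = 1 \/ (-1 : R[i]) = -1 by right.
  apply: half_abelian_symplectic eps1 _ _ tri jordan erefl _.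
  + rewrite /= /std_form tr_block_mx !trmx0 trmx1 linearN /= trmx1 scaleN1r.
    by rewrite opp_block_mx !oppr0 opprK.
  + suff /mulmx1_unit[] : std_form R[i] TypeC r *m (- std_form R[i] TypeC r) = 1%:M by [].
    rewrite mulmxN /= mulmx_block !(mulmx0, mul0mx, mul1mx, mulmx1, add0r, addr0).
    by rewrite opp_block_mx !oppr0 opprK scalar_mx_block.
  + by rewrite /= oddD addbb.
- have W_odd := fun i => weight_dim_odd (i := i) (sym1 _) (unitmx1 _ _) tri jordan erefl.
  apply: iff_trans (half_abelian_orthogonal (or_introl erefl) (sym1 _) (unitmx1 _ _) tri jordan erefl) _.
  apply: iff_trans (iff_sym (listed_even_orthogonal p0 W_odd)).
  have -> : odd (std_dim TypeD r) = false by rewrite /= oddD addbb.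
  split; case.
  + by constructor 1.
  + by case=> p1 _; constructor 2.
  + by constructor 3.
  + by constructor 1.
  + by move=> p1; constructor 2; split; [|left].
  + by constructor 3.
Qed.
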